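(* For every positive integer $n$, $mnl(K_{4,n}) = 2\binom{n}{4}$, and this minimum is realized by the fan embedding of $K_{4,n}$.
   Context: An embedding of a finite graph $G$ means a tame embedding of $G$ in $\mathbb{R}^3$. A cycle is a simple closed cycle of the graph. A link in an embedding is an unordered pair of vertex-disjoint cycles of $G$ whose images form a non-trivial (non-split) two-component link (no three pairwise disjoint cycles exist in the graph considered here, so all links have two components); links are counted as pairs of cycles. $mnl(G)$ is the minimal number of links in any embedding of $G$ in $\mathbb{R}^3$. $K_{m,n}$ is the complete bipartite graph with parts of sizes $m$ and $n$, and $\binom{n}{4}=0$ for $n<4$. The fan embedding of $K_{m,n}$ is the embedding described by the following projection (diagram) in the plane. Denote the two sets of independent vertices by $a_1,\dots,a_m$ and $b_1,\dots,b_n$. Place $a_i$ at the point $(i,0)$ on the $x$-axis and $b_j$ at the point $(0,j)$ on the $y$-axis, and draw each edge as the line segment $\overline{a_ib_j}$. Two segments $\overline{a_ib_j}$ and $\overline{a_kb_l}$ with $k>i$ cross if and only if $j>l$, and in this case $\overline{a_ib_j}$ crosses over $\overline{a_kb_l}$. *)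

(* Defs.v *)
From HB Require Import structures.
From mathcomp Require Import all_boot all_order all_algebra.
From mathcomp Require Import all_classical all_reals all_analysis.

Set Implicit Arguments.
Unset Strict Implicit.
Unset Printing Implicit Defensive.
Import Order.TTheory GRing.Theory Num.Theory.
Import numFieldNormedType.Exports.
Local Open Scope classical_set_scope.
Local Open Scope ring_scope.

Record sgraph := SGraph {
  vertex :> finType;
  adj : rel vertex;
  adj_sym : symmetric adj;
  adj_irr : irreflexive adj }.

Definition Kadj m n (u v : 'I_m + 'I_n) : bool :=
  match u, v with
  | inl _, inr _ | inr _, inl _ => true
  | _, _ => false
  end.

Lemma Kadj_sym m n : symmetric (@Kadj m n).
Proof. by case=> ? []. Qed.

Lemma Kadj_irr m n : irreflexive (@Kadj m n).
Proof. by case. Qed.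

Definition K (m n : nat) : sgraph := SGraph (@Kadj_sym m n) (@Kadj_irr m n).

(* A cycle is identified with its set of edges, an edge being the set of its
   two ends; rotating or reversing the vertex sequence gives the same cycle. *)
Definition is_cycle (G : sgraph) (C : {set {set G}}) : Prop :=
  exists c : seq G, [/\ (2 < size c)%N, ucycle (@adj G) c &
    C = [set [set x; next c x] | x in c]%SET].

Section Space.
Variable R : realType.

Definition homeomorphism (h : 'rV[R]_3 -> 'rV[R]_3) : Prop :=
  continuous h /\
  exists g : 'rV[R]_3 -> 'rV[R]_3, [/\ continuous g, cancel h g & cancel g h].

Definition segment n (p q : 'rV[R]_n) : set 'rV[R]_n :=
  [set (1 - t) *: p + t *: q | t in `[0, 1]].

Fixpoint polyline (p : 'rV[R]_3) (s : seq 'rV[R]_3) : set 'rV[R]_3 :=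
  if s is q :: s' then segment p q `|` polyline q s' else [set p].

(* The arc of an edge is given for both orientations of the edge; only its
   values on [0, 1], and only for adjacent vertices, are meaningful.
   [emb_disj], [emb_vert], [emb_inj] and [vert_inj] together say that the map
   induced on the geometric realization of G (a compact space) is injective.
   Tameness is equivalence to a polygonal embedding under a homeomorphism of
   the ambient space. *)
Record embedding (G : sgraph) := Embedding {
  vert : G -> 'rV[R]_3;
  arc : G -> G -> R -> 'rV[R]_3;
  vert_inj : injective vert;
  arc0 : forall x y, adj x y -> arc x y 0 = vert x;
  arc1 : forall x y, adj x y -> arc x y 1 = vert y;
  arc_rev : forall x y, adj x y ->
    forall t, t \in `[0, 1] -> arc y x t = arc x y (1 - t);
  emb_cont : forall x y, adj x y -> {within `[0, 1], continuous (arc x y)};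
  emb_inj : forall x y, adj x y -> {in `[0, 1] &, injective (arc x y)};
  emb_vert : forall x y z, adj x y -> z != x -> z != y ->
    ~ (arc x y @` `[0, 1]) (vert z);
  emb_disj : forall x y u v, adj x y -> adj u v ->
    [set x; y]%SET != [set u; v]%SET ->
    (arc x y @` `[0, 1]) `&` (arc u v @` `[0, 1]) `<=`
      [set vert z | z in [set z | z \in [set x; y]%SET :&: [set u; v]%SET]];
  emb_tame : exists2 h, homeomorphism h &
    forall x y, adj x y -> exists2 s, last (h (vert x)) s = h (vert y) &
      h @` (arc x y @` `[0, 1]) = polyline (h (vert x)) s }.

Definition edge_image (G : sgraph) (f : embedding G) (x y : G)
  : set 'rV[R]_3 := arc f x y @` `[0, 1].

Definition cycle_image (G : sgraph) (f : embedding G) (C : {set {set G}})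
  : set 'rV[R]_3 :=
  [set p | exists x y, [/\ adj x y, [set x; y]%SET \in C & edge_image f x y p]].

(* The two components can be carried to opposite sides of a plane by a
   homeomorphism of the ambient space.  Equivalently a tame 2-sphere disjoint
   from the link separates its components. *)
Definition split_link (A B : set 'rV[R]_3) : Prop :=
  exists h, [/\ homeomorphism h,
    forall p, A p -> 0 < h p 0 ord_max &
    forall p, B p -> h p 0 ord_max < 0].

Definition links (G : sgraph) (f : embedding G) : {set {set {set {set G}}}} :=
  [set L : {set {set {set G}}} | `[< exists C D,
    [/\ L = [set C; D]%SET, is_cycle C /\ is_cycle D,
        [disjoint finset.cover C & finset.cover D] &
        ~ split_link (cycle_image f C) (cycle_image f D)] >]]%SET.

Definition nlinks (G : sgraph) (f : embedding G) : nat := #|links f|.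

(* The default value 0 of [xget] is only used for a graph without embedding. *)
Definition mnl (G : sgraph) : nat :=
  xget 0%N [set k | (exists f : embedding G, nlinks f = k) /\
                    (forall f : embedding G, (k <= nlinks f)%N)].

Definition proj (p : 'rV[R]_3) : 'rV[R]_2 :=
  \row_(k < 2) p 0 (widen_ord (leqnSn 2) k).

Definition height (p : 'rV[R]_3) : R := p 0 ord_max.

Definition pt (x y : R) : 'rV[R]_2 := \row_(k < 2) (if k == 0 then x else y).

(* [f] is presented by the fan diagram under projection along the third axis.
   Ordinals start at 0, so [inl i] is a_(i+1) and [inr j] is b_(j+1).  The last
   clause speaks about all pairs of points of the two edges lying over the same
   point of the plane, that is, over the crossing. *)
Definition is_fan m n (f : embedding (K m n)) : Prop :=
  [/\ forall i : 'I_m, proj (vert f (inl i)) = pt i.+1%:R 0,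
      forall j : 'I_n, proj (vert f (inr j)) = pt 0 j.+1%:R,
      forall (i : 'I_m) (j : 'I_n),
        proj @` edge_image f (inl i) (inr j) = segment (pt i.+1%:R 0) (pt 0 j.+1%:R)
        /\ {in `[0, 1] &, injective (proj \o arc f (inl i) (inr j))} &
      forall (i k : 'I_m) (j l : 'I_n), (i < k)%N -> (l < j)%N ->
        forall p q, edge_image f (inl i) (inr j) p ->
          edge_image f (inl k) (inr l) q -> proj p = proj q ->
          height q < height p].

End Space.

(* Main.v *)
From mathcomp Require Import all_boot all_order all_algebra perm.
From mathcomp Require Import all_classical all_reals all_analysis.
From mathcomp Require Import ring lra zify.
Require Import Defs.

(** The two cycles of a link in K_{4,n} are disjoint and each uses at least two of the four
    vertices a_i, so both are 4-cycles and the link lies in exactly one of the 'C(n, 4)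
    subgraphs K_{4,4}.  It remains to see that every K_{4,4} contains at least two links, and
    exactly two in the fan embedding.

    Lower bound.  Tameness makes the embedding polygonal, and a small perturbation puts
    finitely many points of it into general position ([generic_perturbation]).  Let lk(C, D)
    be the parity of the number of places where C passes over D in the vertical projection.
    - lk(C, D) = 0 if a homeomorphism separates C from D: the half-space containing C is
      contractible, so C is swept to a point within it along a fine grid, and each small
      triangle of the grid contributes 0 because D does not meet it
      ([overpass_triangle], [linking_separated]).
    - Consider the nine pairs of complementary 4-cycles with a_0 in C and b_0 in D.  In the sum
      of their numbers lk(C, D) the contributions of two disjoint edges cancel, except for
      edges that avoid a_0 and b_0, which contribute in both orders.  So the sum is the parity
      of the number of crossings between disjoint edges of K_{3,3} = K_{4,4} - a_0 - b_0.
      That number is odd for every drawing of K_{3,3}: it does not change when edges are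
      straightened, and for straight edges it follows from identities about four and five
      points ([K33_parity], [K44_linked]).
    Hence for any choice of a_0 and b_0 some link separates these two vertices
    ([K44_nonsplit]).  Apply this twice, the second time to two vertices on the same cycle of
    the first link; the two links obtained are different ([two_links]).

    Upper bound.  In the fan diagram the edge a_i b_j is over a_k b_l whenever they cross and
    i < k.  If one cycle is over the other, a vertical push separates them ([above_split]).  If
    the vertices a_i, or the vertices b_j, of one cycle lie between those of the other, then the
    outer cycle consists of an upper star and a lower star with the inner cycle between them,
    and the lower star can be pushed aside horizontally ([sandwich_split]).  These cases cover
    all pairs except those where both kinds of vertices interleave; there are two such pairs
    for each four vertices b_j ([fan_link_order], [nlinks_upper]).  The fan diagram itself is
    realized by straight segments, with the vertices on two skew lines ([fan_exists]). *)

Set Implicit Arguments.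
Unset Strict Implicit.
Unset Printing Implicit Defensive.
Import Order.TTheory GRing.Theory Num.Theory.
Local Open Scope ring_scope.

(** * Signs of determinants of points in general position *)

Section Signs.
Variable R : realFieldType.
Implicit Types p q r s t : 'rV[R]_3.

(** The signs of these two determinants carry all the geometry used below: the third
    coordinate is the height, and pictures are drawn in the first two. *)
Definition orient p q r : R :=
  (q 0 0 - p 0 0) * (r 0 1 - p 0 1) - (q 0 1 - p 0 1) * (r 0 0 - p 0 0).

Definition volume p q r s : R :=
  (s 0 ord_max - p 0 ord_max) * orient p q r - (r 0 ord_max - p 0 ord_max) * orient p q s
  + (q 0 ord_max - p 0 ord_max) * orient p r s.

(** For points in general position: the projections of the segments pq and rs cross. *)
Definition cross p q r s : bool :=
  ((0 < orient p q r) (+) (0 < orient p q s)) && ((0 < orient r s p) (+) (0 < orient r s q)).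

(** At the crossing the height of pq minus that of rs has the sign of
    volume p q r s * orient p q s. *)
Definition over p q r s : bool :=
  cross p q r s && ((0 < volume p q r s) == (0 < orient p q s)).

(** The projection of s lies in that of the triangle pqr. *)
Definition inside p q r s : bool :=
  ((0 < orient p q s) == (0 < orient q r s)) && ((0 < orient q r s) == (0 < orient r p s)).

(** The point s lies under the triangle pqr. *)
Definition below p q r s : bool :=
  inside p q r s && ((0 < volume p q r s) != (0 < orient p q r)).

(** The segment st meets the triangle pqr in space. *)
Definition pierce p q r s t : bool :=
  ((0 < volume p q r s) (+) (0 < volume p q r t)) &&
  ((0 < volume p q s t) == (0 < volume q r s t)) &&
    ((0 < volume q r s t) == (0 < volume r p s t)).

Lemma gt0_mul (x y : R) : x != 0 -> y != 0 -> (0 < x * y) = ((0 < x) == (0 < y)).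
Proof.
move=> x0 y0; case: (ltgtP 0 x) x0 => // hx _; case: (ltgtP 0 y) y0 => // hy _.
- by rewrite pmulr_rgt0.
- by rewrite pmulr_rgt0 // (ltNge 0 y) ltW.
- by rewrite nmulr_rgt0 // (ltNge y 0) ltW.
- by rewrite nmulr_rgt0.
Qed.

Lemma gt0_opp (x : R) : x != 0 -> (0 < - x) = ~~ (0 < x).
Proof. by move=> x0; rewrite oppr_gt0 -leNgt le_eqVlt (negPf x0). Qed.

Lemma sum0_signs (x y z : R) : x != 0 -> y != 0 -> z != 0 -> x + y + z = 0 ->
  ~~ (((0 < x) == (0 < y)) && ((0 < y) == (0 < z))).
Proof.
move=> x0 y0 z0 e; case: (ltgtP 0 x) x0 => // hx _;
  case: (ltgtP 0 y) y0 => // hy _; case: (ltgtP 0 z) z0 => // hz _; exfalso; lra.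
Qed.

Lemma orient_rot p q r : orient q r p = orient p q r.
Proof. by rewrite /orient; ring. Qed.

Lemma orient_swap p q r : orient q p r = - orient p q r.
Proof. by rewrite /orient; ring. Qed.

Lemma orient_flip p q r : orient p r q = - orient p q r.
Proof. by rewrite /orient; ring. Qed.

Lemma volume_swap p q r s : volume q p r s = - volume p q r s.
Proof. by rewrite /volume /orient; ring. Qed.

(** What the three-term Grassmann-Pluecker relation aa' - bb' + cc' = 0 between nonzero
    determinants says about their signs. *)
Definition plucker_sign (a a' b b' c c' : bool) : bool :=
  ~~ (((a == a') == (b != b')) && ((b != b') == (c == c'))).

Lemma plucker_signP (a a' b b' c c' : R) : a != 0 -> a' != 0 -> b != 0 -> b' != 0 ->
  c != 0 -> c' != 0 -> a * a' - b * b' + c * c' = 0 ->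
  plucker_sign (0 < a) (0 < a') (0 < b) (0 < b') (0 < c) (0 < c').
Proof.
move=> a0 a0' b0 b0' c0 c0' e.
have := @sum0_signs (a * a') (- (b * b')) (c * c').
rewrite oppr_eq0 !mulf_neq0 // gt0_opp ?mulf_neq0 // !gt0_mul // /plucker_sign => /(_ _ _ _ e) h.
have {}h := h isT isT isT.
by move: h; do 6 case: (0 < _).
Qed.

Lemma cross_sym p q r s : cross p q r s = cross r s p q.
Proof. by rewrite /cross andbC. Qed.

Lemma cross_rev p q r s : orient p q r != 0 -> orient p q s != 0 ->
  cross q p r s = cross p q r s.
Proof.
move=> h1 h2; rewrite /cross !(orient_swap p q) !gt0_opp //.
by do 4 case: (0 < _).
Qed.
End Signs.

(** Boolean functions of n arguments, with a decision procedure for tautologies; it makes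
    the case analysis over fifteen signs a single computation. *)
Fixpoint bfun n := if n is m.+1 then bool -> bfun m else bool.
Fixpoint taut n : bfun n -> bool :=
  if n is m.+1 return bfun n -> bool
  then fun f => taut (f true) && taut (f false) else id.
Fixpoint bforall n : bfun n -> Prop :=
  if n is m.+1 return bfun n -> Prop
  then fun f => forall b, bforall (f b) else is_true.
Lemma tautP n (f : bfun n) : taut f -> bforall f.
Proof. by elim: n f => //= n IH f /andP[ht hf] []; apply: IH. Qed.

Section Identities.
Variable R : realFieldType.
Implicit Types p q r s t : 'rV[R]_3.

Local Notation o p q r := (0 < orient p q r).
Local Notation v p q r s := (0 < volume p q r s).

Local Ltac plucker := by apply: plucker_signP => //; rewrite /volume /orient; ring.
Local Ltac revert_signs :=
  repeat match goal with g : is_true (plucker_sign _ _ _ _ _ _) |- is_true _ =>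
    move: g; apply/implyP end.

(** A line that enters a triangle also leaves it: the segment st crosses the boundary of pqr
    once for each of its ends inside.  The three-term relations between the ten signs of
    five points leave only sign patterns for which this parity holds. *)
Lemma triangle_cross p q r s t
  (pqr : orient p q r != 0) (pqs : orient p q s != 0) (pqt : orient p q t != 0)
  (prs : orient p r s != 0) (prt : orient p r t != 0) (pst : orient p s t != 0)
  (qrs : orient q r s != 0) (qrt : orient q r t != 0) (qst : orient q s t != 0)
  (rst : orient r s t != 0) :
  cross p q s t (+) cross q r s t (+) cross r p s t
    = inside p q r s (+) inside p q r t.
Proof.
have g0 : plucker_sign (o p q r) (o p s t) (o p q s) (o p r t) (o p q t) (o p r s) by plucker.
have g1 : plucker_sign (o p q r) (o q s t) (o p q s) (o q r t) (o p q t) (o q r s) by plucker.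
have g2 : plucker_sign (o p q r) (o r s t) (o p r s) (o q r t) (o p r t) (o q r s) by plucker.
have g3 : plucker_sign (o p q s) (o r s t) (o p r s) (o q s t) (o p s t) (o q r s) by plucker.
have g4 : plucker_sign (o p q t) (o r s t) (o p r t) (o q s t) (o p s t) (o q r t) by plucker.
rewrite /cross /inside !(orient_swap p r).
rewrite (orient_rot p s t) (orient_rot q s t) (orient_rot r s t) !gt0_opp //.
apply/eqP; revert_signs.
match goal with |- is_true ?G =>
  let G' := eval pattern
    (o p q r), (o p q s), (o p q t), (o p r s), (o p r t), (o p s t), (o q r s), (o q r t),
    (o q s t), (o r s t) in G in
  match G' with ?F _ _ _ _ _ _ _ _ _ _ =>
    exact (@tautP 10 F (erefl true) _ _ _ _ _ _ _ _ _ _)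
  end end.
Qed.

(** The four faces of a flattened tetrahedron cover each point of the plane an even number
    of times. *)
Lemma inside_tetra p q r s t
  (pqr : orient p q r != 0) (pqs : orient p q s != 0) (pqt : orient p q t != 0)
  (prs : orient p r s != 0) (prt : orient p r t != 0) (pst : orient p s t != 0)
  (qrs : orient q r s != 0) (qrt : orient q r t != 0) (qst : orient q s t != 0)
  (rst : orient r s t != 0) :
  inside p q r t (+) inside p q s t (+) inside p r s t (+) inside q r s t = false.
Proof.
have g0 : plucker_sign (o p q r) (o p s t) (o p q s) (o p r t) (o p q t) (o p r s) by plucker.
have g1 : plucker_sign (o p q r) (o q s t) (o p q s) (o q r t) (o p q t) (o q r s) by plucker.
have g2 : plucker_sign (o p q r) (o r s t) (o p r s) (o q r t) (o p r t) (o q r s) by plucker.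
have g3 : plucker_sign (o p q s) (o r s t) (o p r s) (o q s t) (o p s t) (o q r s) by plucker.
have g4 : plucker_sign (o p q t) (o r s t) (o p r t) (o q s t) (o p s t) (o q r t) by plucker.
rewrite /inside !(orient_swap p r) !(orient_swap p s) !(orient_swap q s) !gt0_opp //.
apply/eqP; revert_signs.
match goal with |- is_true ?G =>
  let G' := eval pattern
    (o p q r), (o p q s), (o p q t), (o p r s), (o p r t), (o p s t), (o q r s), (o q r t),
    (o q s t), (o r s t) in G in
  match G' with ?F _ _ _ _ _ _ _ _ _ _ =>
    exact (@tautP 10 F (erefl true) _ _ _ _ _ _ _ _ _ _)
  end end.
Qed.

(** The triangle pqr and the three vertical walls hanging from its sides bound an unbounded
    prism.  The segment st meets this boundary once, modulo 2, for each of its ends in the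
    prism; it meets the wall under a side exactly where that side passes over st.  The
    determinants orient are volumes with one vertex at vertical infinity, so the relations
    needed are those of six points in space. *)
Lemma triangle_over p q r s t
  (pqrs : volume p q r s != 0) (pqrt : volume p q r t != 0) (pqr : orient p q r != 0)
  (pqst : volume p q s t != 0) (pqs : orient p q s != 0) (pqt : orient p q t != 0)
  (prst : volume p r s t != 0) (prs : orient p r s != 0) (prt : orient p r t != 0)
  (pst : orient p s t != 0) (qrst : volume q r s t != 0) (qrs : orient q r s != 0)
  (qrt : orient q r t != 0) (qst : orient q s t != 0) (rst : orient r s t != 0) :
  over p q s t (+) over q r s t (+) over r p s t
    = pierce p q r s t (+) below p q r s (+) below p q r t.
Proof.
have g0 :
  plucker_sign (v p q r s) (o p q t) (v p q r t) (o p q s) (o p q r) (v p q s t) by plucker.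
have g1 :
  plucker_sign (v p q r s) (o p r t) (v p q r t) (o p r s) (o p q r) (v p r s t) by plucker.
have g2 :
  plucker_sign (v p q r s) (o p s t) (v p q s t) (o p r s) (o p q s) (v p r s t) by plucker.
have g3 :
  plucker_sign (v p q r t) (o p s t) (v p q s t) (o p r t) (o p q t) (v p r s t) by plucker.
have g4 : plucker_sign (o p q r) (o p s t) (o p q s) (o p r t) (o p q t) (o p r s) by plucker.
have g5 :
  plucker_sign (v p q r s) (o q r t) (v p q r t) (o q r s) (o p q r) (v q r s t) by plucker.
have g6 :
  plucker_sign (v p q r s) (o q s t) (v p q s t) (o q r s) (o p q s) (v q r s t) by plucker.
have g7 :
  plucker_sign (v p q r t) (o q s t) (v p q s t) (o q r t) (o p q t) (v q r s t) by plucker.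
have g8 : plucker_sign (o p q r) (o q s t) (o p q s) (o q r t) (o p q t) (o q r s) by plucker.
have g9 :
  plucker_sign (v p q r s) (o r s t) (v p r s t) (o q r s) (o p r s) (v q r s t) by plucker.
have g10 :
  plucker_sign (v p q r t) (o r s t) (v p r s t) (o q r t) (o p r t) (v q r s t) by plucker.
have g11 : plucker_sign (o p q r) (o r s t) (o p r s) (o q r t) (o p r t) (o q r s) by plucker.
have g12 :
  plucker_sign (v p q s t) (o r s t) (v p r s t) (o q s t) (o p s t) (v q r s t) by plucker.
have g13 : plucker_sign (o p q s) (o r s t) (o p r s) (o q s t) (o p s t) (o q r s) by plucker.
have g14 : plucker_sign (o p q t) (o r s t) (o p r t) (o q s t) (o p s t) (o q r t) by plucker.
rewrite /over /pierce /below /cross /inside !(orient_swap p r).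
rewrite (orient_rot p s t) (orient_rot q s t) (orient_rot r s t) !(volume_swap p r) !gt0_opp //.
apply/eqP; revert_signs.
match goal with |- is_true ?G =>
  let G' := eval pattern
    (v p q r s), (v p q r t), (o p q r), (v p q s t), (o p q s), (o p q t), (v p r s t),
    (o p r s), (o p r t), (o p s t), (v q r s t), (o q r s), (o q r t), (o q s t),
      (o r s t) in G in
  match G' with ?F _ _ _ _ _ _ _ _ _ _ _ _ _ _ _ =>
    exact (@tautP 15 F (erefl true) _ _ _ _ _ _ _ _ _ _ _ _ _ _ _)
  end end.
Qed.

(** Four points in the plane are either in convex position, and then exactly one of the three
    pairs of opposite segments crosses, or one of them lies in the triangle of the others. *)
Lemma four_points p q r s (pqr : orient p q r != 0) (pqs : orient p q s != 0)
  (prs : orient p r s != 0) (qrs : orient q r s != 0) :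
  cross p q r s (+) cross p r q s (+) cross p s q r
    (+) inside p q r s (+) inside p q s r (+) inside p r s q (+) inside q r s p
    = true.
Proof.
have e : orient q r s - orient p r s + orient p q s - orient p q r = 0 by rewrite /orient; ring.
have c : ~~ (((0 < orient q r s) != (0 < orient p r s)) &&
  ((0 < orient q r s) == (0 < orient p q s))
    && ((0 < orient q r s) != (0 < orient p q r))).
  case: (ltgtP 0 (orient q r s)) qrs => // h1 _; case: (ltgtP 0 (orient p r s)) prs => // h2 _;
  case: (ltgtP 0 (orient p q s)) pqs => // h3 _; case: (ltgtP 0 (orient p q r)) pqr => // h4 _;
  exfalso; lra.
rewrite /cross /inside !(orient_rot p q) !(orient_rot p r) !(orient_rot q r) -!(orient_rot s p).
rewrite !(orient_flip p q) !(orient_flip q r s) !(orient_flip p r s).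
rewrite !(orient_swap p r) !(orient_swap q s) !(orient_rot p q s) !gt0_opp //.
by move: c; do 4 case: (0 < _).
Qed.
End Identities.

Section MoreSigns.
Variable R : realFieldType.
Implicit Types p q r s t : 'rV[R]_3.

Lemma over_rev p q r s : orient p q r != 0 -> orient p q s != 0 -> volume p q r s != 0 ->
  over q p r s = over p q r s.
Proof.
move=> h1 h2 h3; rewrite /over cross_rev // (volume_swap p q) (orient_swap p q) !gt0_opp //.
by congr andb; do 2 case: (0 < _).
Qed.

Lemma over_cross p q r s :
  orient p q r != 0 -> orient p q s != 0 -> orient r s p != 0 -> orient r s q != 0 ->
  over p q r s (+) over r s p q = cross p q r s.
Proof.
move=> pqr pqs rsp rsq; rewrite /over (cross_sym r s).
have -> : volume r s p q = volume p q r s by rewrite /volume /orient; ring.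
have e : orient p q s - orient p q r + orient r s q - orient r s p = 0 by rewrite /orient; ring.
have c : ~~ (((0 < orient p q s) != (0 < orient p q r)) &&
  ((0 < orient p q s) == (0 < orient r s q))
    && ((0 < orient p q s) != (0 < orient r s p))).
  case: (ltgtP 0 (orient p q r)) pqr => // h1 _; case: (ltgtP 0 (orient p q s)) pqs => // h2 _;
  case: (ltgtP 0 (orient r s p)) rsp => // h3 _; case: (ltgtP 0 (orient r s q)) rsq => // h4 _;
  exfalso; lra.
move: c; rewrite /cross; by do 5 case: (0 < _).
Qed.

(** The affine relation between five points in space gives the point of intersection. *)
Lemma pierceP p q r s t :
  volume p q r s != 0 -> volume p q r t != 0 -> volume p q s t != 0 -> volume q r s t != 0 ->
  volume r p s t != 0 -> pierce p q r s t ->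
  exists a b c u, [/\ [/\ 0 <= a, 0 <= b & 0 <= c], a + b + c = 1, 0 <= u <= 1 &
    a *: p + b *: q + c *: r = (1 - u) *: s + u *: t].
Proof.
move=> hs ht h1 h2 h3; rewrite /pierce.
set k := volume p q r s in hs *; set l := volume p q r t in ht *.
set c := volume p q s t in h1 *; set a := volume q r s t in h2 *; set b := volume r p s t in h3 *.
have e : a + b + c = l - k by rewrite /a /b /c /l /k /volume /orient; ring.
have ev : a *: p + b *: q + c *: r = l *: s - k *: t.
  apply/rowP => -[[|[|[|//]]] i]; rewrite !mxE;
    [have -> : Ordinal i = 0 by exact/val_inj
    |have -> : Ordinal i = 1 by exact/val_inj
    |have -> : Ordinal i = ord_max by exact/val_inj];
  rewrite /a /b /c /l /k /volume /orient; ring.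
move=> /andP[/andP[hk /eqP hc] /eqP ha].
have d0 : l - k != 0.
  apply/eqP => d; move: hk; rewrite (_ : l = k) ?addbb //; lra.
have [ga gb gc gk gl] : [/\ 0 <= a / (l - k), 0 <= b / (l - k), 0 <= c / (l - k),
    0 <= - k / (l - k) & 0 <= l / (l - k)].
  case: (ltgtP 0 k) hs hk => // hk0 _; case: (ltgtP 0 l) ht => // hl0 _ // _;
  case: (ltgtP 0 a) h2 ha hc => // ha0 _; case: (ltgtP 0 b) h3 => // hb0 _ //;
  case: (ltgtP 0 c) h1 => // hc0 _ // _ _; try (exfalso; lra).
  - have d1 : l - k <= 0 by lra.
    by split; apply: mulr_le0; rewrite ?invr_le0 //; lra.
  - have d1 : 0 <= l - k by lra.
    by split; apply: mulr_ge0; rewrite ?invr_ge0 //; lra.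
exists (a / (l - k)), (b / (l - k)), (c / (l - k)), (- k / (l - k)); split.
- by split.
- by rewrite -!mulrDl e divff.
- rewrite gk /=; have -> : - k / (l - k) = 1 - l / (l - k) by field.
  lra.
have -> : 1 - - k / (l - k) = l / (l - k) by field.
by rewrite ![_ / _]mulrC -!scalerA -!scalerDr ev scaleNr.
Qed.
End MoreSigns.

(** * Crossing parity of K_{3,3} and linking in K_{4,4} *)

Section PathSums.
Variable T : eqType.
Implicit Types (F G : T -> T -> bool) (p : T) (l : seq T).

Fixpoint path_sum F p l : bool := if l is q :: l' then F p q (+) path_sum F q l' else false.

Definition steps p l : seq (T * T) := zip (p :: l) l.

Lemma steps_mem p l x y : (x, y) \in steps p l -> x \in p :: l /\ y \in p :: l.
Proof.
rewrite /steps; elim: l p => //= q l IH p; rewrite inE => /orP[/eqP[-> ->]|/IH[hx hy]].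
  by rewrite !inE !eqxx orbT.
by split; rewrite inE; apply/orP; right.
Qed.

Lemma eq_path_sum_steps F G p l : {in steps p l, forall e, F e.1 e.2 = G e.1 e.2} ->
  path_sum F p l = path_sum G p l.
Proof.
elim: l p => //= q l IH p e; rewrite (e (p, q)) ?mem_head // (IH q) // => x hx.
by apply: e; rewrite inE hx orbT.
Qed.

Lemma eq_path_sum F G p l : {in p :: l &, F =2 G} -> path_sum F p l = path_sum G p l.
Proof. by move=> e; apply: eq_path_sum_steps => -[x y] /steps_mem[]; exact: e. Qed.

Lemma path_sumD F G p l :
  path_sum (fun x y => F x y (+) G x y) p l = path_sum F p l (+) path_sum G p l.
Proof. by elim: l p => //= q l IH p; rewrite IH addbACA. Qed.

(** Contributions that are differences of a potential telescope along a path; modulo 2, a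
    difference is a sum. *)
Lemma path_sum_potential F (w : T -> bool) p l :
  {in steps p l, forall e, F e.1 e.2 = w e.1 (+) w e.2} ->
  path_sum F p l = w p (+) w (last p l).
Proof.
move=> e; rewrite (eq_path_sum_steps (G := fun x y => w x (+) w y) e) {e}.
elim: l p => /= [|q l IH] p; first by rewrite addbb.
by rewrite IH; case: (w p); case: (w q); case: (w (last q l)).
Qed.

Lemma path_sum_exchange (F : T -> T -> T -> T -> bool) p l q m :
  path_sum (fun x y => path_sum (fun s t => F x y s t) q m) p l
  = path_sum (fun s t => path_sum (fun x y => F x y s t) p l) q m.
Proof.
elim: l p => /= [|p' l IH] p; last by rewrite IH path_sumD.
by elim: m q => //= q' m ->.
Qed.
End PathSums.

Section XorCancel.
Variable T : eqType.

(** Used with explicit lists of more than a hundred terms, this reduces the cancellation of equal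
    terms to counting multiplicities by computation. *)
Lemma xor_cancel (g : T -> bool) (s : seq T) :
  all (fun x => ~~ odd (count_mem x s)) s -> \big[addb/false]_(x <- s) g x = false.
Proof.
move=> /allP h; rewrite -big_undup_iterop_count big_seq big1 // => x.
rewrite mem_undup => /h; rewrite Monoid.iteropE.
elim: (count_mem x s) {-2}(count_mem x s) (leqnn (count_mem x s)) => [|m IH] [|[|n]] //= le.
rewrite negbK => /IH ->; last by rewrite -ltnS ltnW.
by rewrite addbF addbb.
Qed.

Lemma xor_cat (g : T -> bool) (s t : seq T) : \big[addb/false]_(x <- s ++ t) g x
  = \big[addb/false]_(x <- s) g x (+) \big[addb/false]_(x <- t) g x.
Proof. exact: big_cat. Qed.
End XorCancel.

Definition pairs3 : seq (nat * nat) := [:: (1, 2); (1, 3); (2, 3)]%N.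

(** Unordered pairs of disjoint edges of K_{3,3}, both parts being numbered 1, 2, 3; the
    condition i < k makes each pair occur once. *)
Definition disjoint_pairs : seq ((nat * nat) * (nat * nat)) :=
  [seq ((ik.1, jl.1), (ik.2, jl.2))
    | ik <- pairs3, jl <- pairs3 ++ [seq (e.2, e.1) | e <- pairs3]].

Section General.
Variables (R : realFieldType) (f : 'rV[R]_3 -> 'rV[R]_3) (X : seq 'rV[R]_3).
Implicit Types o p q r s t : 'rV[R]_3.

(** The points themselves serve as labels of their perturbed positions f p, so that coinciding
    sample points stay equal and only distinct points have to be independent. *)
Definition generic :=
  (forall p q r, uniq [:: p; q; r] -> all (mem X) [:: p; q; r] ->
    orient (f p) (f q) (f r) != 0) /\
  (forall p q r s, uniq [:: p; q; r; s] -> all (mem X) [:: p; q; r; s] ->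
    volume (f p) (f q) (f r) (f s) != 0).

Hypothesis gX : generic.

Definition crossing p q s t := cross (f p) (f q) (f s) (f t).
Definition overpass p q s t := over (f p) (f q) (f s) (f t).
Definition in_triangle p q r s := inside (f p) (f q) (f r) (f s).
Definition under_triangle p q r s := below (f p) (f q) (f r) (f s).

Lemma generic_orient p q r : p != q -> p != r -> q != r -> p \in X -> q \in X -> r \in X ->
  orient (f p) (f q) (f r) != 0.
Proof.
move=> pq pr qr hp hq hr; apply: gX.1; rewrite /= ?inE ?negb_or ?pq ?pr ?qr //.
by rewrite hp hq hr.
Qed.

Lemma generic_volume p q r s : p != q -> p != r -> p != s -> q != r -> q != s -> r != s ->
  p \in X -> q \in X -> r \in X -> s \in X -> volume (f p) (f q) (f r) (f s) != 0.
Proof.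
move=> pq pr ps qr qs rs hp hq hr hs; apply: gX.2.
  by rewrite /= !inE !negb_or pq pr ps qr qs rs.
by rewrite /= hp hq hr hs.
Qed.

Lemma crossing_pp p s t : crossing p p s t = false.
Proof. by rewrite /crossing /cross /orient !subrr !mul0r subrr ltxx. Qed.

Lemma crossing_ss p q s : crossing p q s s = false.
Proof. by rewrite /crossing cross_sym; exact: crossing_pp. Qed.

Lemma overpass_pp p s t : overpass p p s t = false.
Proof. by have := crossing_pp p s t; rewrite /overpass /over /crossing => ->. Qed.

Lemma overpass_ss p q s : overpass p q s s = false.
Proof. by have := crossing_ss p q s; rewrite /overpass /over /crossing => ->. Qed.

Lemma crossing_sym p q s t : crossing p q s t = crossing s t p q.
Proof. exact: cross_sym. Qed.

Lemma crossing_rev p q s t : p \in X -> q \in X -> s \in X -> t \in X ->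
  p != s -> p != t -> q != s -> q != t -> crossing q p s t = crossing p q s t.
Proof.
move=> hp hq hs ht ps pt qs qt; have [->//|pq] := eqVneq p q.
by apply: cross_rev; apply: generic_orient.
Qed.

Lemma overpass_rev p q s t : p \in X -> q \in X -> s \in X -> t \in X ->
  p != s -> p != t -> q != s -> q != t -> overpass q p s t = overpass p q s t.
Proof.
move=> hp hq hs ht ps pt qs qt; have [->//|pq] := eqVneq p q.
have [->|st] := eqVneq s t; first by rewrite !overpass_ss.
by apply: over_rev; [apply: generic_orient|apply: generic_orient|apply: generic_volume].
Qed.

Lemma overpass_crossing p q s t : p \in X -> q \in X -> s \in X -> t \in X ->
  p != s -> p != t -> q != s -> q != t -> overpass p q s t (+) overpass s t p q =
    crossing p q s t.
Proof.
move=> hp hq hs ht ps pt qs qt.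
have [->|pq] := eqVneq p q; first by rewrite overpass_pp overpass_ss crossing_pp.
have [->|st] := eqVneq s t; first by rewrite overpass_pp overpass_ss crossing_ss.
by apply: over_cross; apply: generic_orient; rewrite // eq_sym.
Qed.

Lemma in_triangle_pp p r s : p \in X -> r \in X -> s \in X -> p != r -> p != s -> r != s ->
  [/\ in_triangle p p r s = false, in_triangle p r p s = false & in_triangle r p p s = false].
Proof.
move=> hp hr hs pr ps rs.
have orient0 x y : orient x x y = 0 :> R by rewrite /orient !subrr !mul0r subrr.
have := generic_orient pr ps rs hp hr hs; rewrite /in_triangle /inside !orient0 ltxx.
by rewrite (orient_swap (f p) (f r)) => h; rewrite gt0_opp //; case: (0 < orient _ _ _).
Qed.

(** Unlike [triangle_cross], this allows repeated vertices, which occur in polygons that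
    backtrack. *)
Lemma crossing_triangle p q r s t :
  p \in X -> q \in X -> r \in X -> s \in X -> t \in X ->
  s \notin [:: p; q; r] -> t \notin [:: p; q; r] ->
  crossing p q s t (+) crossing q r s t (+) crossing r p s t = in_triangle p q r s
    (+) in_triangle p q r t.
Proof.
move=> hp hq hr hs ht; rewrite !inE !negb_or => /and3P[sp sq sr] /and3P[tp tq tr].
have [<-|st] := eqVneq s t; first by rewrite !crossing_ss !addbb.
rewrite eq_sym in sp; rewrite eq_sym in sq; rewrite eq_sym in sr.
rewrite eq_sym in tp; rewrite eq_sym in tq; rewrite eq_sym in tr.
have [pq|pq] := eqVneq p q.
  subst q; rewrite crossing_pp /= (crossing_rev hp hr hs ht) // addbb.
  have [pr|pr] := eqVneq p r.
    subst r; rewrite /in_triangle /inside; have orient0 y : orient (f p) (f p) y = 0 :> R.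
      by rewrite /orient !subrr !mul0r subrr.
    by rewrite !orient0 ltxx.
  have [-> _ _] := in_triangle_pp hp hr hs pr sp sr.
  by have [-> _ _] := in_triangle_pp hp hr ht pr tp tr.
have [qr|qr] := eqVneq q r.
  subst r; rewrite crossing_pp addbF (crossing_rev hp hq hs ht) // addbb.
  have [_ _ ->] : [/\ in_triangle q q p s = false, in_triangle q p q s =
    false & in_triangle p q q s = false].
    by apply: in_triangle_pp; rewrite // eq_sym.
  by have [_ _ ->] : [/\ in_triangle q q p t = false, in_triangle q p q t =
    false & in_triangle p q q t = false];
    first by apply: in_triangle_pp; rewrite // eq_sym.
have [pr|pr] := eqVneq p r.
  subst r; rewrite crossing_pp addbF (crossing_rev hp hq hs ht) // addbb.
  have [_ -> _] := in_triangle_pp hp hq hs pq sp sq.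
  by have [_ -> _] := in_triangle_pp hp hq ht pq tp tq.
by apply: triangle_cross; apply: generic_orient.
Qed.

Lemma under_in_triangle p q r s : in_triangle p q r s = false -> under_triangle p q r s = false.
Proof. by rewrite /in_triangle /under_triangle /below => ->. Qed.

(** If st does not meet the triangle pqr, then the number of sides that pass over st is a
    difference of a function of the end points of st.  Summed over a closed polygon instead of
    st it is therefore 0. *)
Lemma overpass_triangle p q r s t :
  p \in X -> q \in X -> r \in X -> s \in X -> t \in X ->
  s \notin [:: p; q; r] -> t \notin [:: p; q; r] ->
  ~~ (uniq [:: p; q; r; s; t] && pierce (f p) (f q) (f r) (f s) (f t)) ->
  overpass p q s t (+) overpass q r s t (+) overpass r p s t = under_triangle p q r s
    (+) under_triangle p q r t.
Proof.
move=> hp hq hr hs ht; rewrite !inE !negb_or => /and3P[sp sq sr] /and3P[tp tq tr].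
have [<-|st] := eqVneq s t; first by rewrite !overpass_ss !addbb.
rewrite eq_sym in sp; rewrite eq_sym in sq; rewrite eq_sym in sr.
rewrite eq_sym in tp; rewrite eq_sym in tq; rewrite eq_sym in tr.
have [pq|pq] := eqVneq p q.
  subst q; rewrite overpass_pp /= (overpass_rev hp hr hs ht) // addbb.
  have [pr|pr] := eqVneq p r.
    subst r; rewrite /under_triangle /below /volume; have orient0 y : orient (f p) (f p) y =
      0 :> R.
      by rewrite /orient !subrr !mul0r subrr.
    by rewrite !orient0 !subrr !(mul0r, mulr0, subr0, addr0) ltxx !andbF.
  have [/under_in_triangle -> _ _] := in_triangle_pp hp hr hs pr sp sr.
  by have [/under_in_triangle -> _ _] := in_triangle_pp hp hr ht pr tp tr.
have [qr|qr] := eqVneq q r.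
  subst r; rewrite overpass_pp addbF (overpass_rev hp hq hs ht) // addbb.
  have [_ _ /under_in_triangle ->] : [/\ in_triangle q q p s = false, in_triangle q p q s =
    false & in_triangle p q q s = false].
    by apply: in_triangle_pp; rewrite // eq_sym.
  by have [_ _ /under_in_triangle ->] : [/\ in_triangle q q p t = false, in_triangle q p q t =
    false & in_triangle p q q t = false];
    first by apply: in_triangle_pp; rewrite // eq_sym.
have [pr|pr] := eqVneq p r.
  subst r; rewrite overpass_pp addbF (overpass_rev hp hq hs ht) // addbb.
  have [_ /under_in_triangle -> _] := in_triangle_pp hp hq hs pq sp sq.
  by have [_ /under_in_triangle -> _] := in_triangle_pp hp hq ht pq tp tq.
rewrite /overpass triangle_over; [|(exact: generic_orient || exact: generic_volume)..].
by rewrite /= !inE !negb_or pq pr sp tp qr sq tq sr tr st /= => /negbTE ->.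
Qed.

(** Parity of the winding number, around u, of the path p, l closed up by a segment; computed
    by coning from p. *)
Definition winding p l (u : 'rV[R]_3) := path_sum (fun x y => in_triangle p x y u) p l.

(** Straightening a path changes its crossings with st by the winding numbers of the closed
    curve formed by the path and its chord around s and t. *)
Lemma crossing_path p l s t : {subset p :: l <= X} -> s \in X -> t \in X ->
  s \notin p :: l -> t \notin p :: l ->
  path_sum (fun x y => crossing x y s t) p l
  = crossing p (last p l) s t (+) winding p l s (+) winding p l t.
Proof.
move=> hX hs ht ns nt; have hp : p \in X by apply: hX; rewrite mem_head.
suff H q m : {subset q :: m <= p :: l} ->
    path_sum (fun x y => crossing x y s t) q m = crossing p q s t (+) crossing p (last q m) s t
     (+) path_sum (fun x y => in_triangle p x y s) q m (+) path_sum (fun x y =>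
       in_triangle p x y t) q m.
  by rewrite H // crossing_pp.
elim: m q => [|r m IH] q sub /=; first by rewrite addbb.
have hin z : z \in p :: l -> [/\ z \in X, z != s & z != t].
  by move=> hz; split; [exact: hX|apply: contraNneq ns => <-|apply: contraNneq nt => <-].
have [qX qs qt] : [/\ q \in X, q != s & q != t] by apply: hin; apply: sub; rewrite mem_head.
have [rX rs rt] : [/\ r \in X, r != s & r != t].
  by apply: hin; apply: sub; rewrite !inE eqxx orbT.
have [_ ps pt] := hin p (mem_head _ _).
rewrite IH; last by move=> z hz; apply: sub; rewrite inE hz orbT.
have := crossing_triangle hp qX rX hs ht; rewrite !inE !negb_or ![s == _]eq_sym ![t == _]eq_sym.
rewrite ps qs rs pt qt rt (crossing_rev hp rX hs ht) // => /(_ isT isT).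
move: (crossing p q s t) (crossing q r s t) (crossing p r s t) (crossing p (last r m) s t).
move: (in_triangle p q r s) (in_triangle p q r t) (path_sum _ r m) (path_sum _ r m).
by do 8 case.
Qed.

Lemma four_points_crossing p q r s : uniq [:: p; q; r; s] -> all (mem X) [:: p; q; r; s] ->
  crossing p q r s (+) crossing p r q s (+) crossing p s q r
    (+) in_triangle p q r s (+) in_triangle p q s r (+) in_triangle p r s q
      (+) in_triangle q r s p = true.
Proof.
rewrite /= !inE !negb_or => /and4P[/and3P[pq pr ps] /andP[qr qs] rs _].
by move=> /and5P[hp hq hr hs _]; apply: four_points; apply: generic_orient.
Qed.

Lemma five_points_inside p q r s t : uniq [:: p; q; r; s; t] -> all (mem X) [:: p; q; r; s; t] ->
  in_triangle p q r t (+) in_triangle p q s t (+) in_triangle p r s t (+) in_triangle q r s t =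
    false.
Proof.
rewrite /= !inE !negb_or => /and5P[/and4P[pq pr ps pt] /and3P[qr qs qt] /andP[rs rt] st _].
by move=> /and5P[hp hq hr hs /andP[ht _]]; apply: inside_tetra; apply: generic_orient.
Qed.

Section SixPoints.
Variable v : nat -> 'rV[R]_3.
Hypothesis v_inj : {in iota 1 6 &, injective v}.
Hypothesis vX : forall i, i \in iota 1 6 -> v i \in X.

(* Formal terms, so that cancellation can be computed: (true, [:: i; j; k; l]) is the crossing
   of v_i v_j with v_k v_l, and (false, [:: i; j; k; l]) says whether v_l is in the triangle
   v_i v_j v_k. *)
Let value (x : bool * seq nat) : bool :=
  if x.2 is [:: i; j; k; l] then
    (if x.1 then crossing else in_triangle) (v i) (v j) (v k) (v l) else false.
Let four (i j k l : nat) := [:: (true, [:: i; j; k; l]); (true, [:: i; k; j; l]);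
  (true, [:: i; l; j; k]); (false, [:: i; j; k; l]); (false, [:: i; j; l; k]);
  (false, [:: i; k; l; j]); (false, [:: j; k; l; i])].
Let three (i j k l m : nat) := [:: (true, [:: i; j; l; m]); (true, [:: j; k; l; m]);
  (true, [:: i; k; l; m]); (false, [:: i; j; k; l]); (false, [:: i; j; k; m])].
Let five (i j k l m : nat) := [:: (false, [:: i; j; k; m]); (false, [:: i; j; l; m]);
  (false, [:: i; k; l; m]); (false, [:: j; k; l; m])].

Let fourP (i j k l : nat) : uniq [:: i; j; k; l] -> all (mem (iota 1 6)) [:: i; j; k; l] ->
  \big[addb/false]_(x <- four i j k l) value x = true.
Proof.
move=> u h; rewrite !big_cons big_nil addbF /value /= !addbA; apply: four_points_crossing.
  rewrite -[X in uniq X]/(map v [:: i; j; k; l]) map_inj_in_uniq // => x y hx hy.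
  by apply: v_inj; apply: (allP h).
by move: h; rewrite /= => /and5P[*]; rewrite !vX.
Qed.

Let fiveP (i j k l m : nat) : uniq [:: i; j; k; l; m] ->
  all (mem (iota 1 6)) [:: i; j; k; l; m] ->
  \big[addb/false]_(x <- five i j k l m) value x = false.
Proof.
move=> u h; rewrite !big_cons big_nil addbF /value /= !addbA; apply: five_points_inside.
  rewrite -[X in uniq X]/(map v [:: i; j; k; l; m]) map_inj_in_uniq // => x y hx hy.
  by apply: v_inj; apply: (allP h).
by move: h; rewrite /= => /and5P[h1 h2 h3 h4 /andP[h5 _]]; rewrite !vX.
Qed.

Let threeP (i j k l m : nat) : uniq [:: i; j; k; l; m] ->
  all (mem (iota 1 6)) [:: i; j; k; l; m] ->
  \big[addb/false]_(x <- three i j k l m) value x = false.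
Proof.
move=> u h; have /= : uniq (map v [:: i; j; k; l; m]).
  by rewrite map_inj_in_uniq // => x y hx hy; apply: v_inj; apply: (allP h).
rewrite !inE !negb_or => /and5P[/and4P[ij ik il im] /and3P[jk jl jm] /andP[kl km] lm _].
move: h => /= /and5P[h1 h2 h3 h4 /andP[h5 _]].
rewrite !big_cons big_nil addbF /value /= !addbA -[crossing (v i) (v k) _ _]crossing_rev ?vX //.
rewrite crossing_triangle; [by rewrite -addbA addbb|exact: vX..| |].
  by rewrite !inE !negb_or ![v l == _]eq_sym il jl kl.
by rewrite !inE !negb_or ![v m == _]eq_sym im jm km.
Qed.

(** A straight-line drawing of K_{3,3}, with parts 1, 2, 3 and 4, 5, 6, has an odd number of
    crossings of disjoint edges.  Add the relation [four_points] over the nine choices of two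
    vertices from each part.  The crossings of the edges of the triangle 123 with those of
    456 cancel because closed curves cross evenly, and the points in triangles cancel
    by [inside_tetra]; what remains is nine times 1. *)
Lemma six_points : \big[addb/false]_(x <- disjoint_pairs)
  crossing (v x.1.1) (v (3 + x.1.2)) (v x.2.1) (v (3 + x.2.2)) = true.
Proof.
pose bs := [:: (4, 5); (4, 6); (5, 6)]%N.
pose r4 := [seq four ac.1 ac.2 bd.1 bd.2 | ac <- pairs3, bd <- bs].
pose r3 := [seq three 1 2 3 bd.1 bd.2 | bd <- bs].
pose r5 := [seq five ac.1 4 5 6 ac.2 | ac <- pairs3 ++ [seq (e.2, e.1) | e <- pairs3]]
  ++ [seq five 1 2 3 bd.1 bd.2 | bd <- bs ++ [seq (e.2, e.1) | e <- bs]].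
pose cr := [seq (true, [:: x.1.1; 3 + x.1.2; x.2.1; 3 + x.2.2]%N) | x <- disjoint_pairs].
have : \big[addb/false]_(x <- cr ++ flatten r4 ++ flatten r3 ++ flatten r5) value x = false.
  by apply: xor_cancel; vm_compute.
rewrite (xor_cat _ cr) (xor_cat _ (flatten r4)) (xor_cat _ (flatten r3)).
have -> : \big[addb/false]_(x <- flatten r4) value x = true.
  rewrite big_flatten (eq_big_seq (fun => true)); first by rewrite big_const_seq.
  move=> r; do 8 (rewrite inE; case/orP=> [/eqP ->|]; first exact: fourP).
  by rewrite inE => /eqP ->; exact: fourP.
have -> : \big[addb/false]_(x <- flatten r3) value x = false.
  rewrite big_flatten big_seq big1 // => r.
  do 2 (rewrite inE; case/orP=> [/eqP ->|]; first exact: threeP).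
  by rewrite inE => /eqP ->; exact: threeP.
have -> : \big[addb/false]_(x <- flatten r5) value x = false.
  rewrite big_flatten big_seq big1 // => r.
  do 11 (rewrite inE; case/orP=> [/eqP ->|]; first exact: fiveP).
  by rewrite inE => /eqP ->; exact: fiveP.
by rewrite big_map !addbF addbT => /negbFE.
Qed.
End SixPoints.

(** Polygonal paths c i j from a i to b j for the sixteen edges of K_{4,4}. *)
Section Bipartite.
Variables (a b : nat -> 'rV[R]_3) (c : nat -> nat -> seq 'rV[R]_3).
Hypothesis c_last : forall i j : nat, last (a i) (c i j) = b j.
Hypothesis c_X : forall i j : nat, {subset a i :: c i j <= X}.
Hypothesis c_disj : forall i j k l : nat, (i < 4)%N -> (j < 4)%N ->
  (k < 4)%N -> (l < 4)%N -> i != k -> j != l ->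
  {in a i :: c i j, forall x, x \notin a k :: c k l}.

Definition edge_over (e g : nat * nat) :=
  path_sum (fun x y => path_sum (fun s t =>
    overpass x y s t) (a g.1) (c g.1 g.2)) (a e.1) (c e.1 e.2).
Definition edge_cross (e g : nat * nat) :=
  path_sum (fun x y => path_sum (fun s t =>
    crossing x y s t) (a g.1) (c g.1 g.2)) (a e.1) (c e.1 e.2).

Let bc (i j : nat) : b j \in a i :: c i j.
Proof. by rewrite -(c_last i j) mem_last. Qed.

Lemma edge_over_cross (i j k l : nat) : (i < 4)%N -> (j < 4)%N ->
  (k < 4)%N -> (l < 4)%N -> i != k -> j != l ->
  edge_over (i, j) (k, l) (+) edge_over (k, l) (i, j) = edge_cross (i, j) (k, l).
Proof.
move=> i4 j4 k4 l4 ik jl; rewrite /edge_over [X in _ (+) X]path_sum_exchange -path_sumD.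
apply: eq_path_sum => x y hx hy; rewrite -path_sumD; apply: eq_path_sum => s t hs ht.
have xX := c_X hx; have yX := c_X hy; have sX := c_X hs; have tX := c_X ht.
have nx := c_disj i4 j4 k4 l4 ik jl hx; have ny := c_disj i4 j4 k4 l4 ik jl hy.
by rewrite overpass_crossing //; first [apply: contraNneq nx => -> | apply: contraNneq ny => ->].
Qed.

(** Straighten first one edge, then the other. *)
Lemma edge_cross_straight (i j k l : nat) : (i < 4)%N -> (j < 4)%N ->
  (k < 4)%N -> (l < 4)%N -> i != k -> j != l ->
  edge_cross (i, j) (k, l) = crossing (a i) (b j) (a k) (b l)
    (+) winding (a i) (c i j) (a k) (+) winding (a i) (c i j) (b l)
    (+) winding (a k) (c k l) (a i) (+) winding (a k) (c k l) (b j).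
Proof.
move=> i4 j4 k4 l4 ik jl; rewrite /edge_cross path_sum_exchange.
have ki : k != i by rewrite eq_sym. have lj : l != j by rewrite eq_sym.
have -> : path_sum (fun s t => path_sum (fun x y => crossing x y s t) (a i) (c i j)) (a k) (c k l)
  = path_sum (fun s t => crossing s t (a i) (b j) (+)
      (winding (a i) (c i j) s (+) winding (a i) (c i j) t)) (a k) (c k l).
  apply: eq_path_sum => s t hs ht; rewrite crossing_path ?c_last;
    first by rewrite addbA (crossing_sym s t).
  - exact: c_X.
  - exact: c_X hs.
  - exact: c_X ht.
  - exact: c_disj k4 l4 i4 j4 ki lj _ hs.
  - exact: c_disj k4 l4 i4 j4 ki lj _ ht.
rewrite path_sumD; set w := winding (a i) (c i j).
have -> : path_sum (fun s t => w s (+) w t) (a k) (c k l) = w (a k) (+) w (b l).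
  by rewrite (path_sum_potential (w := w)) // c_last.
rewrite crossing_path ?c_last; first 1 last.
- exact: c_X.
- exact: c_X (mem_head _ _).
- exact: c_X (bc i j).
- exact: c_disj i4 j4 k4 l4 ik jl _ (mem_head _ _).
- exact: c_disj i4 j4 k4 l4 ik jl _ (bc i j).
rewrite (crossing_sym (a k)).
move: (crossing _ _ _ _) (w (a k)) (w (b l)) (winding _ _ _) (winding _ _ _).
by do 5 case.
Qed.

(** In the sum of the corrections of [edge_cross_straight], each winding number of the edge ij
    around another vertex occurs for the two edges at this vertex that are disjoint from ij. *)
Lemma K33_parity : \big[addb/false]_(x <- disjoint_pairs) edge_cross x.1 x.2 = true.
Proof.
pose v i := if (i <= 3)%N then a i else b (i - 3).
pose w (x : nat * nat * nat) := winding (a x.1.1) (c x.1.1 x.1.2) (v x.2).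
pose h (x : (nat * nat) * (nat * nat)) := [:: (x.1, x.2.1); (x.1, (3 + x.2.2)%N);
  (x.2, x.1.1); (x.2, (3 + x.1.2)%N)].
have e x : x \in disjoint_pairs -> edge_cross x.1 x.2 =
    crossing (v x.1.1) (v (3 + x.1.2)) (v x.2.1) (v (3 + x.2.2))
     (+) \big[addb/false]_(y <- h x) w y.
  rewrite !big_cons big_nil addbF /disjoint_pairs /pairs3 /=.
  do 17 (rewrite inE; case/orP=> [/eqP ->|]; first by rewrite edge_cross_straight //= -!addbA).
  by rewrite inE => /eqP ->; rewrite edge_cross_straight //= -!addbA.
rewrite (eq_big_seq _ e) big_split /= six_points.
- have -> : \big[addb/false]_(x <- disjoint_pairs) \big[addb/false]_(y <- h x) w y
      = \big[addb/false]_(y <- flatten (map h disjoint_pairs)) w y by rewrite [RHS]big_flatten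
        [RHS]big_map.
  by rewrite xor_cancel.
- have ne (x y : 'rV[R]_3) (m : seq 'rV[R]_3) : x \in m -> y \notin m -> y != x.
    by move=> hx; apply: contraNneq => ->.
  have hab i k : (i < 4)%N -> (k < 4)%N -> a i != b k.
    move=> hi hk; pose i' : nat := (i == 0)%N; pose k' : nat := (k == 0)%N.
    apply: (ne _ _ (a i' :: c i' k)); first exact: bc.
    apply: (c_disj (i := i) (j := k')) (mem_head _ _) => //.
    - by rewrite /k'; case: (k).
    - by rewrite /i'; case: (i).
    - by rewrite /i'; case: (i).
    - by rewrite /k'; case: (k).
  have haa i k : (i < 4)%N -> (k < 4)%N -> i != k -> a i != a k.
    move=> hi hk ik; apply: (ne _ _ (a k :: c k 1%N)); first exact: mem_head.
    exact: (c_disj (i := i) (j := 0%N)) (mem_head _ _).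
  have hbb i k : (i < 4)%N -> (k < 4)%N -> i != k -> b i != b k.
    move=> hi hk ik; apply: (ne _ _ (a 1%N :: c 1%N k)); first exact: bc.
    exact: (c_disj (i := 0%N) (j := i)) (bc _ _).
  move=> x y; rewrite !mem_iota /v => /andP[x0 x7] /andP[y0 y7].
  case: leqP => hx; case: leqP => hy /eqP; apply: contraTeq => xy.
  + exact: haa.
  + by apply: hab => //; lia.
  + by rewrite eq_sym; apply: hab => //; lia.
  + by apply: hbb => //; lia.
- by move=> i _; rewrite /v; case: ifP => _; [exact: c_X (mem_head _ _)|exact: c_X (bc 0 _)].
Qed.

Definition cycle_edges (s t : seq nat) : seq (nat * nat) := [seq (x, y) | x <- s, y <- t].

(** Edges e of the cycle through a_0 and a_i avoiding b_0 and b_p, with edges g of the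
    complementary cycle. *)
Definition lk2_pairs (i p : nat) :=
  [seq (e, g) | e <- cycle_edges [:: 0; i]%N (rem p [:: 1; 2; 3]%N),
     g <- cycle_edges (rem i [:: 1; 2; 3]%N) [:: 0; p]%N].
Definition lk2 (i p : nat) : bool := \big[addb/false]_(x <- lk2_pairs i p) edge_over x.1 x.2.

(** Count how often e over g occurs in the nine linking numbers: an odd number of times exactly
    if e and g are disjoint edges avoiding a_0 and b_0. *)
Lemma K44_linked :
  exists i p : nat, [/\ (0 < i < 4)%N, (0 < p < 4)%N & lk2 i p].
Proof.
pose sw (x : (nat * nat) * (nat * nat)) := (x.2, x.1).
pose ips := [seq (i, k) | i <- [:: 1; 2; 3]%N, k <- [:: 1; 2; 3]%N].
have e x : x \in disjoint_pairs -> edge_cross x.1 x.2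
    = edge_over x.1 x.2 (+) edge_over (sw x).1 (sw x).2.
  rewrite /disjoint_pairs /pairs3 /=.
  do 17 (rewrite inE; case/orP=> [/eqP ->|]; first by rewrite edge_over_cross).
  by rewrite inE => /eqP ->; rewrite edge_over_cross.
have := K33_parity; rewrite (eq_big_seq _ e) big_split /= => h.
have : \big[addb/false]_(x <- flatten [seq lk2_pairs ip.1 ip.2 | ip <- ips]
    ++ (disjoint_pairs ++ map sw disjoint_pairs)) edge_over x.1 x.2 = false.
  by apply: xor_cancel; vm_compute.
rewrite xor_cat (xor_cat _ disjoint_pairs) [X in _ (+) (_ (+) X)]big_map h addbT => /negbFE.
have [/hasP[[i p] /allpairsP[[i' p'] [hi hp [-> ->]]] hl] _|/hasPn no] :=
    boolP (has (fun ip => lk2 ip.1 ip.2) ips).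
  by exists i', p'; split => //; [move: hi|move: hp]; rewrite /= !inE => /or3P[] /eqP ->.
rewrite big_flatten big_map big_seq big1 // => ip /no /negbTE; exact.
Qed.
End Bipartite.
End General.

Import numFieldNormedType.Exports.
Local Open Scope classical_set_scope.
Local Open Scope ring_scope.

(** * Perturbation to general position *)

Section Perturbation.
Variable R : realType.
Implicit Types (p q r s : 'rV[R]_3) (X : seq 'rV[R]_3).

Lemma near_all (T : eqType) (I : Type) (F : set_system I) (l : seq T)
    (P : T -> I -> Prop) : Filter F ->
  (forall x, x \in l -> \forall i \near F, P x i) ->
  \forall i \near F, forall x, x \in l -> P x i.
Proof.
move=> FF; elim: l => [|x l IH] h; first by apply: nearW.
have hx := h x (mem_head _ _).
have hl : \forall i \near F, forall y, y \in l -> P y i.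
  by apply: IH => y yl; apply: h; rewrite inE yl orbT.
near=> i => y; rewrite inE => /orP[/eqP ->|]; [near: i; exact: hx|].
by move: y; near: i; exact: hl.
Unshelve. all: by end_near. Qed.

(** By repeated use, a polynomial with a nonzero coefficient has no zero in some interval to the
    right of 0. *)
Lemma near_neq0_step (c : R) (g : R -> R) : continuous g ->
  (\forall e \near 0^'+, g e != 0) -> \forall e \near 0^'+, c + e * g e != 0.
Proof.
move=> cg h; have [->|c0] := eqVneq c 0.
  by near=> e; rewrite add0r mulf_neq0 //; near: e.
have : (fun e => c + e * g e) @ 0 --> c + 0 * g 0.
  by apply: cvgD; [exact: cvg_cst|apply: cvgM; [exact: cvg_id|exact: cg]].
rewrite mul0r addr0 => /cvgr_neq0 /(_ c0) h0.
exact: cvg_within h0.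
Unshelve. all: by end_near. Qed.

Lemma near_quadratic (c0 c1 c2 : R) : c2 != 0 ->
  \forall e \near 0^'+, c0 + e * (c1 + e * c2) != 0.
Proof.
move=> h; apply: near_neq0_step => [e|].
  by apply: cvgD; [exact: cvg_cst|apply: cvgM; [exact: cvg_id|exact: cvg_cst]].
apply: near_neq0_step => [e|]; first exact: cvg_cst.
exact: nearW.
Qed.

Lemma near_cubic (c0 c1 c2 c3 : R) : c3 != 0 ->
  \forall e \near 0^'+, c0 + e * (c1 + e * (c2 + e * c3)) != 0.
Proof.
move=> h; apply: near_neq0_step => [e|]; last exact: near_quadratic.
apply: cvgD; [exact: cvg_cst|apply: cvgM; [exact: cvg_id|]].
by apply: cvgD; [exact: cvg_cst|apply: cvgM; [exact: cvg_id|exact: cvg_cst]].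
Qed.

(** Points on the moment curve are in general position: their determinants are Vandermonde
    determinants. *)
Definition moment (t : R) : 'rV[R]_3 :=
  \row_k (if k == 0 then t else if k == 1 then t ^+ 2 else t ^+ 3).

Lemma moment0 t : moment t 0 0 = t. Proof. by rewrite mxE eqxx. Qed.
Lemma moment1 t : moment t 0 1 = t ^+ 2. Proof. by rewrite mxE. Qed.
Lemma moment2 t : moment t 0 ord_max = t ^+ 3. Proof. by rewrite mxE. Qed.

Lemma orient_moment (x y z : R) :
  orient (moment x) (moment y) (moment z) = (y - x) * (z - x) * (z - y).
Proof. rewrite /orient !moment0 !moment1; ring. Qed.

Lemma volume_moment (x y z t : R) : volume (moment x) (moment y) (moment z) (moment t)
  = (y - x) * (z - x) * (t - x) * (z - y) * (t - y) * (t - z).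
Proof. rewrite /volume /orient !moment0 !moment1 !moment2; ring. Qed.

(** The coefficient of e ^+ 2 is the determinant of the moment points, hence nonzero. *)
Lemma near_orient p q r (x y z : R) : x != y -> x != z -> y != z ->
  \forall e \near 0^'+,
    orient (p + e *: moment x) (q + e *: moment y) (r + e *: moment z) != 0.
Proof.
move=> xy xz yz; pose c2 := orient (moment x) (moment y) (moment z).
have h2 : c2 != 0 by rewrite /c2 orient_moment !mulf_neq0 // subr_eq0 eq_sym.
apply: filterS (near_quadratic (orient p q r)
  (orient (p + moment x) (q + moment y) (r + moment z) - orient p q r - c2) h2) => e.
congr (_ != _); rewrite /c2 /orient !mxE; ring.
Qed.

(** Likewise for the coefficient of e ^+ 3; the coefficients in between are the mixed terms of
    the trilinear expansion. *)
Lemma near_volume p q r s (x y z t : R) :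
  x != y -> x != z -> x != t -> y != z -> y != t -> z != t ->
  \forall e \near 0^'+, volume (p + e *: moment x) (q + e *: moment y)
    (r + e *: moment z) (s + e *: moment t) != 0.
Proof.
move=> xy xz xt yz yt zt; pose c3 := volume (moment x) (moment y) (moment z) (moment t).
have h3 : c3 != 0 by rewrite /c3 volume_moment !mulf_neq0 // subr_eq0 eq_sym.
pose m u := moment u - moment x.
apply: filterS (near_cubic (volume p q r s)
  (volume 0 (m y) (r - p) (s - p) + volume 0 (q - p) (m z) (s - p) + volume 0 (q - p) (r - p)
    (m t))
  (volume 0 (q - p) (m z) (m t) + volume 0 (m y) (r - p) (m t) + volume 0 (m y) (m z) (s - p))
    h3) => e.
by congr (_ != _); rewrite /c3 /m /volume /orient !mxE; ring.
Qed.

(** Move the point of index t in X by e times the point of parameter t on the moment curve.  Each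
    determinant vanishes for finitely many e only, so all are nonzero for small e > 0. *)
Lemma generic_perturbation X (d : R) : 0 < d -> exists f : 'rV[R]_3 -> 'rV[R]_3,
  generic f X /\ forall x, x \in X -> `|f x - x| < d.
Proof.
move=> d0; pose t x : R := (index x X)%:R.
have tI x y : x \in X -> x != y -> t x != t y.
  move=> hx; apply: contraNneq => /eqP; rewrite eqr_nat => /eqP h.
  by rewrite -(nth_index x hx) h nth_index // -index_mem -h index_mem.
pose f e x := x + e *: moment (t x).
have hD : \forall e \near 0^'+, forall p, p \in X -> forall q, q \in X -> forall r, r \in X ->
    uniq [:: p; q; r] -> orient (f e p) (f e q) (f e r) != 0.
  apply: near_all => p hp; apply: near_all => q hq; apply: near_all => r hr.
  have [u|/negP u] := boolP (uniq [:: p; q; r]); last by apply: nearW.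
  move: u; rewrite /= !inE negb_or => /and3P[/andP[pq pr] qr _].
  by apply: filterS (near_orient p q r (tI _ _ hp pq) (tI _ _ hp pr) (tI _ _ hq qr)).
have hV : \forall e \near 0^'+, forall p, p \in X -> forall q, q \in X -> forall r, r \in X ->
    forall s, s \in X -> uniq [:: p; q; r; s] -> volume (f e p) (f e q) (f e r) (f e s) != 0.
  apply: near_all => p hp; apply: near_all => q hq; apply: near_all => r hr.
  apply: near_all => s hs.
  have [u|/negP u] := boolP (uniq [:: p; q; r; s]); last by apply: nearW.
  move: u; rewrite /= !inE !negb_or => /and4P[/and3P[pq pr ps] /andP[qr qs] rs _].
  by apply: filterS (near_volume p q r s (tI _ _ hp pq) (tI _ _ hp pr) (tI _ _ hp ps)
    (tI _ _ hq qr) (tI _ _ hq qs) (tI _ _ hr rs)).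
have hd : \forall e \near 0^'+, forall x, x \in X -> `|f e x - x| < d.
  apply: near_all => x hx; near=> e.
  rewrite /f addrAC subrr add0r normrZ.
  have e0 : 0 < e by near: e; exact: nbhs_right_gt.
  have h : e < d / (`|moment (t x)| + 1).
    by near: e; apply: nbhs_right_lt; rewrite divr_gt0 // ltr_wpDl.
  rewrite gtr0_norm //; apply: le_lt_trans (_ : e * (`|moment (t x)| + 1) < _).
    by rewrite ler_pM2l // lerDl.
  by rewrite -ltr_pdivlMr // ltr_wpDl.
have [e [[h1 h2] h3]] := filter_ex (filterI (filterI hD hV) hd).
exists (f e); split => //; split.
  by move=> p q r u /= /and4P[hp hq hr _]; exact: h1.
by move=> p q r s u /= /and5P[hp hq hr hs _]; exact: h2.
Unshelve. all: by end_near. Qed.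
End Perturbation.

(** * Separated polygons have even linking number *)

Section Contraction.
Variable R : realType.
Notation V3 := 'rV[R]_3.

Lemma mix_continuous (T : topologicalType) (a : T -> R) (u v : T -> V3) :
  continuous a -> continuous u -> continuous v ->
  continuous (fun x => (1 - a x) *: u x + a x *: v x).
Proof.
move=> ca cu cv x.
exact: (cvgD (cvgZ (cvgB (cvg_cst _) (ca x)) (cu x)) (cvgZ (ca x) (cv x))).
Qed.

(** A Lebesgue number: d-close parameters, and even points d-close to their images, stay in a
    common ball inside O.  Balls are convex, which is what the triangles of the grid need. *)
Lemma cell_radius (f : R * R -> V3) (O : set V3) : open O -> continuous f ->
  (forall s t, 0 <= s <= 1 -> 0 <= t <= 1 -> O (f (s, t))) ->
  \forall d \near 0^'+, forall s t, 0 <= s <= 1 -> 0 <= t <= 1 ->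
    exists c r, ball (c : V3) r `<=` O /\
      forall s' t' (w : V3), `|s' - s| < d -> `|t' - t| < d -> `|w - f (s', t')| < d ->
        ball c r w.
Proof.
move=> oO cf hO.
have /compact_near_coveringP/(_ _ (0 : R)^'+) cov : compact (`[0 : R, 1] `*` `[0 : R, 1]).
  by apply: compact_setX; exact: segment_compact.
pose P (d : R) (x : R * R) := exists c r, ball (c : V3) r `<=` O /\
  forall s' t' (w : V3), `|s' - x.1| < d -> `|t' - x.2| < d -> `|w - f (s', t')| < d ->
    ball c r w.
have key x : (`[0 : R, 1] `*` `[0 : R, 1]) x -> \forall x' \near x & d \near (0 : R)^'+, P d x'.
  case: x => [s0 t0] [/=]; rewrite !in_itv /= => hs ht.
  have /nbhs_ballP[r /= r0 hr] : nbhs (f (s0, t0)) O.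
    by apply: open_nbhs_nbhs; split => //; exact: hO.
  have r2 : 0 < r / 2 by rewrite divr_gt0.
  have /nbhs_ballP[n /= n0 hn] := cf (s0, t0) _ (nbhsx_ballx (f (s0, t0)) _ r2).
  have n2 : 0 < n / 2 by rewrite divr_gt0.
  exists (ball (s0, t0) (n / 2), [set d | d < n / 2 /\ d < r / 2]) => /=.
    split; first exact: nbhsx_ballx.
    by near=> d; split; near: d; exact: nbhs_right_lt.
  move=> [[s t] d] /= [[/= bs bt] [dn dr]]; exists (f (s0, t0)), r; split => //.
  move=> s' t' w /= h1 h2 h3.
  have b1 : ball s0 n s'.
    rewrite [n]splitr; apply: ball_triangle bs _; rewrite -ball_normE /= distrC.
    exact: lt_trans h1 dn.
  have b2 : ball t0 n t'.
    rewrite [n]splitr; apply: ball_triangle bt _; rewrite -ball_normE /= distrC.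
    exact: lt_trans h2 dn.
  rewrite [r]splitr; apply: (@ball_triangle _ _ (f (s', t'))); first exact: hn.
  by rewrite -ball_normE /= distrC; exact: lt_trans h3 dr.
by apply: filterS (cov P _ key) => d h s t hs ht; apply: (h (s, t)); split; rewrite /= in_itv.
Unshelve. all: by end_near. Qed.

Lemma convex_tube (p q : V3) (O : set V3) : open O -> segment p q `<=` O ->
  \forall d \near 0^'+, forall u (w : V3), 0 <= u <= 1 ->
    `|w - ((1 - u) *: p + u *: q)| < d -> O w.
Proof.
move=> oO hO; pose f (x : R * R) := (1 - x.1) *: p + x.1 *: q.
have cf : continuous f.
  by apply: mix_continuous => x; [exact: cvg_fst|exact: cvg_cst|exact: cvg_cst].
have hf s t : 0 <= s <= 1 -> 0 <= t <= 1 -> O (f (s, t)).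
  by move=> hs _; apply: hO; exists s => //=; rewrite in_itv.
apply: filterS2 (nbhs_right_gt 0) (cell_radius oO cf hf) => d d0 k u w hu hw.
have [|c [r [sub k']]] := k u 0 hu; rewrite ?lexx ?ler01 //.
by apply: sub; apply: (k' u 0); rewrite ?subrr ?normr0.
Qed.

Lemma ball_convex (c p q r : V3) (e x y z : R) : 0 <= x -> 0 <= y -> 0 <= z ->
  x + y + z = 1 -> ball c e p -> ball c e q -> ball c e r ->
  ball c e (x *: p + y *: q + z *: r).
Proof.
rewrite -!ball_normE /= => x0 y0 z0 xyz hp hq hr.
have -> : c - (x *: p + y *: q + z *: r) = x *: (c - p) + y *: (c - q) + z *: (c - r).
  apply/matrixP => i j; rewrite !mxE; have -> : x = 1 - y - z by lra.
  ring.
apply: le_lt_trans (ler_normD _ _) _; apply: le_lt_trans (lerD (ler_normD _ _) (lexx _)) _.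
rewrite !normrZ !ger0_norm //.
have [x1|x1] := eqVneq x 0.
  have [y1|y1] := eqVneq y 0; first by have -> : z = 1; [lra|rewrite x1 y1; lra].
  have y2 : 0 < y by rewrite lt_def y1.
  by have : y * `|c - q| < y * e; [rewrite ltr_pM2l|have : z * `|c - r| <= z * e;
    [rewrite ler_wpM2l // ltW|rewrite (_ : z = 1 - y) ?x1; lra]].
have x2 : 0 < x by rewrite lt_def x1.
have h1 : x * `|c - p| < x * e by rewrite ltr_pM2l.
have h2 : y * `|c - q| <= y * e by rewrite ler_wpM2l // ltW.
have h3 : z * `|c - r| <= z * e by rewrite ler_wpM2l // ltW.
have -> : e = x * e + y * e + z * e by rewrite -!mulrDl xyz mul1r.
lra.
Qed.

Lemma hull_close (p q r p' q' r' : V3) (a b c d : R) : 0 <= a -> 0 <= b -> 0 <= c ->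
  a + b + c = 1 -> `|p' - p| < d -> `|q' - q| < d -> `|r' - r| < d ->
  `|(a *: p' + b *: q' + c *: r') - (a *: p + b *: q + c *: r)| < d.
Proof.
move=> a0 b0 c0 abc hp hq hr.
have := @ball_convex 0 (p - p') (q - q') (r - r') d a b c a0 b0 c0 abc.
rewrite -!ball_normE /= !sub0r !opprB => /(_ hp hq hr).
congr (`|_| < _); apply/matrixP => i j; rewrite !mxE; ring.
Qed.

Lemma path_sum_big (T : eqType) (I : Type) (s : seq I) (F : I -> T -> T -> bool) p l :
  path_sum (fun x y => \big[addb/false]_(k <- s) F k x y) p l
  = \big[addb/false]_(k <- s) path_sum (F k) p l.
Proof. by elim: l p => /= [|q l IH] p; [rewrite big1|rewrite IH -big_split]. Qed.

Variables (h g : V3 -> V3).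
Hypotheses (hc : continuous h) (gc : continuous g) (hK : cancel h g) (gK : cancel g h).

Let U := [set x | 0 < h x 0 ord_max].
Let top : V3 := const_mx 1.

(** The homotopy that contracts the segment pq within the half-space, transported by h: the
    second parameter moves h of the segment straight to the point top. *)
Definition sweep (p q : V3) (x : R * R) : V3 :=
  g ((1 - x.2) *: h ((1 - x.1) *: p + x.1 *: q) + x.2 *: top).

Let oU : open U.
Proof.
rewrite (_ : U = (fun x => h x 0 ord_max) @^-1` [set r : R | 0 < r]) //.
apply: open_comp; last exact: open_gt.
by move=> x _; exact: (continuous_comp (@hc x) (@coord_continuous _ _ _ 0 ord_max (h x))).
Qed.

Lemma sweep_continuous p q : continuous (sweep p q).
Proof.
have c1 : continuous (fun x : R * R => (1 - x.1) *: p + x.1 *: q).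
  by apply: mix_continuous => x; [exact: cvg_fst|exact: cvg_cst|exact: cvg_cst].
have c2 : continuous (fun x : R * R =>
    (1 - x.2) *: h ((1 - x.1) *: p + x.1 *: q) + x.2 *: top).
  apply: mix_continuous => x; [exact: cvg_snd| |exact: cvg_cst].
  exact: (continuous_comp (c1 x) (@hc _)).
by move=> x; exact: (continuous_comp (c2 x) (@gc _)).
Qed.

Lemma sweep_U p q s t : segment p q `<=` U -> 0 <= s <= 1 -> 0 <= t <= 1 ->
  U (sweep p q (s, t)).
Proof.
move=> hU hs ht; rewrite /U /sweep /= gK !mxE.
have : U ((1 - s) *: p + s *: q) by apply: hU; exists s => //=; rewrite in_itv.
rewrite /U /=; move: (h _ 0 ord_max) => x x0; rewrite mulr1.
have [-> |t1] := eqVneq t 1; first by rewrite subrr mul0r add0r.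
have : 0 < (1 - t) * x by rewrite mulr_gt0 // subr_gt0 lt_def eq_sym t1 /=; lra.
lra.
Qed.

Lemma sweep0 p q s : sweep p q (s, 0) = (1 - s) *: p + s *: q.
Proof. by rewrite /sweep /= scale0r addr0 subr0 scale1r hK. Qed.

Lemma sweep1 p q s : sweep p q (s, 1) = g top.
Proof. by rewrite /sweep /= subrr scale0r add0r scale1r. Qed.

Definition column (p : V3) (t : R) := g ((1 - t) *: h p + t *: top).

(** On the vertical sides the sweep depends on the end point alone, so adjacent segments of a
    polygon are swept compatibly. *)
Lemma sweep_left p q t : sweep p q (0, t) = column p t.
Proof. by rewrite /sweep /= subr0 scale1r scale0r addr0. Qed.

Lemma sweep_right p q t : sweep p q (1, t) = column q t.
Proof. by rewrite /sweep /= subrr scale0r add0r scale1r. Qed.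

Definition grid M (e : V3 * V3) i j := sweep e.1 e.2 (i%:R / M%:R, j%:R / M%:R).

Lemma fine_grid (E : seq (V3 * V3)) :
  (forall e, e \in E -> segment e.1 e.2 `<=` U) ->
  exists M d, [/\ (0 < M)%N, 0 < d & forall e, e \in E ->
    (forall u w, 0 <= u <= 1 -> `|w - ((1 - u) *: e.1 + u *: e.2)| < d -> U w) /\
    (forall i j, (i < M)%N -> (j < M)%N -> exists c r, ball c r `<=` U /\
      forall i' j' w, (i <= i' <= i.+1)%N -> (j <= j' <= j.+1)%N ->
        `|w - grid M e i' j'| < d -> ball c r w)].
Proof.
move=> hE.
have h1 := near_all (at_right_proper_filter 0) (fun e he => convex_tube oU (hE e he)).
have h2 := near_all (at_right_proper_filter 0) (fun e he => cell_radius oU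
  (@sweep_continuous e.1 e.2) (fun s t => @sweep_U e.1 e.2 s t (hE e he))).
have [d [[d0 {}h1] {}h2]] := filter_ex (filterI (filterI (nbhs_right_gt 0) h1) h2).
pose M := (Num.truncn d^-1).+1.
have M0 : 0 < M%:R :> R by rewrite ltr0n.
have Md : M%:R^-1 < d.
  rewrite invf_plt ?posrE //; exact: truncnS_gt.
exists M, d; split => // e he; split; first exact: h1.
move=> i j iM jM.
have bnd k : (k < M)%N -> 0 <= (k%:R / M%:R : R) <= 1.
  by move=> kM; rewrite divr_ge0 //= ler_pdivrMr // mul1r ler_nat ltnW.
have close k k' : (k <= k' <= k.+1)%N -> `|k'%:R / M%:R - k%:R / M%:R : R| < d.
  move=> /andP[k1 k2]; rewrite -mulrBl -natrB // normrM normr_nat gtr0_norm ?invr_gt0 //.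
  apply: le_lt_trans Md; rewrite ler_piMl ?invr_ge0 // ?ler0n //.
  by rewrite (ler_nat _ _ 1) leq_subLR addn1.
have [c [r [sub k]]] := h2 e he _ _ (bnd i iM) (bnd j jM).
by exists c, r; split => // i' j' w hi hj hw; apply: k hw; exact: close.
Qed.

(** A list of paths in which every point is an end an even number of times; orientations do not
    matter modulo 2. *)
Definition closed_chain (A : seq (V3 * seq V3)) := forall w : V3 -> bool,
  \big[addb/false]_(e <- A) (w e.1 (+) w (last e.1 e.2)) = false.

Definition chain_points (A : seq (V3 * seq V3)) := flatten [seq e.1 :: e.2 | e <- A].

Definition linking (f : V3 -> V3) (A B : seq (V3 * seq V3)) : bool :=
  \big[addb/false]_(e <- A) \big[addb/false]_(k <- B)
    path_sum (fun x y : V3 => path_sum (fun s t : V3 => overpass f x y s t) k.1 k.2) e.1 e.2.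

Lemma polyline_mem (p : V3) l x : x \in p :: l -> polyline p l x.
Proof.
elim: l p => [|q l IH] p; first by rewrite inE => /eqP ->.
rewrite inE => /orP[/eqP ->|]; last by move=> /IH; right.
by left; exists 0; rewrite /= ?in_itv /= ?lexx ?ler01 // subr0 scale1r scale0r addr0.
Qed.

Lemma polyline_steps (p : V3) l e : e \in steps p l -> segment e.1 e.2 `<=` polyline p l.
Proof.
elim: l p => //= q l IH p; rewrite inE => /orP[/eqP ->|he] x hx; first by left.
by right; exact: IH he x hx.
Qed.

Lemma xor_telescope (F u : nat -> bool) M :
  (forall i, (i < M)%N -> F i = u i (+) u i.+1) ->
  \big[addb/false]_(0 <= i < M) F i = u 0 (+) u M.
Proof.
elim: M => [|M IH] hF; first by rewrite big_geq // addbb.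
rewrite big_nat_recr //= IH => [|i iM]; last by apply: hF; exact: ltnW.
by rewrite hF // addbA addbK.
Qed.

(** Let L x y be the number, modulo 2, of passages of the segment xy over B.  It is a cocycle on
    triangles that avoid B: L x y + L y z + L z x = 0.  Summing this over the grid that sweeps
    a segment pq of A shows that L p q = W p + W q, where W sums L along the column above a
    point.  Since A is closed, the sum of L over A vanishes.  The bounds X0 and d only ensure
    that the perturbed triangles still avoid the perturbed B. *)
Lemma linking_separated (A B : seq (V3 * seq V3)) : closed_chain A -> closed_chain B ->
  (forall e, e \in A -> polyline e.1 e.2 `<=` U) ->
  (forall k, k \in B -> polyline k.1 k.2 `<=` [set x | h x 0 ord_max < 0]) ->
  exists (X0 : seq V3) (d : R), 0 < d /\ forall f (X : seq V3), generic f X -> {subset X0 <= X} ->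
    (forall x, x \in X -> `|f x - x| < d) -> linking f A B = false.
Proof.
move=> clA clB hA hB.
pose EA := flatten [seq steps e.1 e.2 | e <- A].
pose EB := flatten [seq steps e.1 e.2 | e <- B].
have oN : open [set x : V3 | h x 0 ord_max < 0].
  rewrite (_ : mkset _ = (fun x => h x 0 ord_max) @^-1` [set r : R | r < 0]) //.
  apply: open_comp; last exact: open_lt.
  by move=> x _; exact: (continuous_comp (@hc x) (@coord_continuous _ _ _ 0 ord_max (h x))).
have sA e : e \in EA -> segment e.1 e.2 `<=` U.
  by move=> /flatten_mapP[k kA ek]; apply: subset_trans (hA k kA); exact: polyline_steps.
have sB e : e \in EB -> segment e.1 e.2 `<=` [set x | h x 0 ord_max < 0].
  by move=> /flatten_mapP[k kA ek]; apply: subset_trans (hB k kA); exact: polyline_steps.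
have [M [d1 [M0 d10 fineA]]] := fine_grid sA.
have [d2 [d20 fineB]] := filter_ex (filterI (nbhs_right_gt 0)
  (near_all (at_right_proper_filter 0) (fun e he => convex_tube oN (sB e he)))).
exists (chain_points B ++ [seq grid M e ij.1 ij.2 | e <- EA,
  ij <- [seq (i, j) | i <- iota 0 M.+1, j <- iota 0 M.+1]]), (Num.min d1 d2).
split=> [|f X gX subX clX]; first by rewrite lt_min d10.
have BX x : x \in chain_points B -> x \in X.
  by move=> hx; apply: subX; rewrite mem_cat hx.
have gridX e i j : e \in EA -> (i <= M)%N -> (j <= M)%N -> grid M e i j \in X.
  move=> he hi hj; apply: subX; rewrite mem_cat; apply/orP; right.
  apply/allpairsP; exists (e, (i, j)); split => //.
  by apply/allpairsP; exists (i, j); rewrite !mem_iota /= !add0n !ltnS.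
have Bneg x : x \in chain_points B -> ~ U x.
  move=> /flatten_mapP[k kB /polyline_mem/(hB k kB)] /= hx; rewrite /U /= => hx'.
  by have := lt_trans hx hx'; rewrite ltxx.
pose L x y := \big[addb/false]_(k <- B) path_sum (fun s t => overpass f x y s t) k.1 k.2.
have Lxx x : L x x = false.
  rewrite /L big1 // => k _; rewrite (path_sum_potential (w := fun=> false)) //.
  by move=> -[s t] _; rewrite overpass_pp.
pose good x := x \in X /\ U x.
have Bmem k s : k \in B -> s \in k.1 :: k.2 -> s \in chain_points B.
  by move=> kB hs; apply/flatten_mapP; exists k.
have goodne x s : good x -> s \in chain_points B -> x != s.
  by move=> [_ Ux] hs; apply: contra_notN (Bneg s hs) => /eqP <-.
have Lsym x y : good x -> good y -> L x y = L y x.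
  move=> gx gy; apply: eq_big_seq => k kB; apply: eq_path_sum => s t hs ht.
  have hs' := Bmem k s kB hs; have ht' := Bmem k t kB ht.
  by apply: (overpass_rev gX); solve [exact: BX | by case: gx | by case: gy | exact: goodne].
have tri x y z : good x -> good y -> good z ->
    (forall a b c : R, 0 <= a -> 0 <= b -> 0 <= c -> a + b + c = 1 ->
      U (a *: f x + b *: f y + c *: f z)) -> L x y (+) L y z (+) L z x = false.
  move=> gx gy gz hull; rewrite /L -!big_split /=.
  rewrite -[RHS](clB (under_triangle f x y z)); apply: eq_big_seq => k kB.
  rewrite -!path_sumD; apply: path_sum_potential => -[s t] st /=.
  have [/(Bmem k _ kB) hs /(Bmem k _ kB) ht] := steps_mem st.
  apply: (overpass_triangle gX); try solve [exact: BX | by case: gx | by case: gy | by case: gz].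
  - by rewrite !inE !negb_or ![s == _]eq_sym !goodne.
  - by rewrite !inE !negb_or ![t == _]eq_sym !goodne.
  apply/negP => /andP[u pc].
  have [uX sX tX] : [/\ x \in X, s \in X & t \in X] by split; [case: gx|exact: BX..].
  have [yX zX] : y \in X /\ z \in X by split; [case: gy|case: gz].
  move: u; rewrite /= !inE !negb_or.
  move=> /and5P[/and4P[xy xz xs xt] /and3P[yz ys yt] /andP[zs zt] st' _].
  have zx : z != x by rewrite eq_sym.
  have [|||||a [b [c [v [[a0 b0 c0] abc hv e]]]]] := pierceP _ _ _ _ _ pc;
    try by apply: (generic_volume gX).
  have := hull a b c a0 b0 c0 abc; rewrite e /U /= => pos.
  have stB : (s, t) \in EB by apply/flatten_mapP; exists k.
  have : `|(1 - v) *: f s + v *: f t - ((1 - v) *: s + v *: t)| < d2.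
    have := @hull_close s t t (f s) (f t) (f t) (1 - v) v 0 d2.
    rewrite !scale0r !addr0; apply; try lra.
    + by have := clX s sX; rewrite lt_min => /andP[].
    + by have := clX t tX; rewrite lt_min => /andP[].
    + by have := clX t tX; rewrite lt_min => /andP[].
  by move=> /(fineB _ stB v _ hv) /= neg; have := lt_trans neg pos; rewrite ltxx.
have clA1 x : x \in X -> `|f x - x| < d1.
  by move=> /clX; rewrite lt_min => /andP[].
have gridU e i j : e \in EA -> (i <= M)%N -> (j <= M)%N -> U (grid M e i j).
  have bnd k : (k <= M)%N -> 0 <= (k%:R / M%:R : R) <= 1.
    by move=> kM; rewrite divr_ge0 //= ler_pdivrMr ?ltr0n // mul1r ler_nat.
  by move=> he hi hj; apply: sweep_U; [exact: sA|exact: bnd|exact: bnd].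
have gridg e i j : e \in EA -> (i <= M)%N -> (j <= M)%N -> good (grid M e i j).
  by move=> he hi hj; split; [exact: gridX|exact: gridU].
pose W p := \big[addb/false]_(0 <= j < M) L (column p (j%:R / M%:R)) (column p (j.+1%:R / M%:R)).
have M1 : M%:R / M%:R = 1 :> R by rewrite divff // pnatr_eq0 -lt0n.
have key e : e \in EA -> L e.1 e.2 = W e.1 (+) W e.2.
  move=> he; pose G := grid M e.
  (* The two triangles of a cell, added together. *)
  have cell i j : (i < M)%N -> (j < M)%N -> L (G i j) (G i.+1 j) (+) L (G i j.+1) (G i.+1 j.+1)
      = L (G i j) (G i j.+1) (+) L (G i.+1 j) (G i.+1 j.+1).
    move=> iM jM; have [hw] := fineA e he; move=> /(_ i j iM jM)[c [r [sub near]]].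
    have gd i' j' : (i <= i' <= i.+1)%N -> (j <= j' <= j.+1)%N -> good (G i' j').
      by move=> /andP[_ h1] /andP[_ h2]; apply: gridg => //;
        [exact: leq_trans h1 iM|exact: leq_trans h2 jM].
    have bl i' j' : (i <= i' <= i.+1)%N -> (j <= j' <= j.+1)%N -> ball c r (f (G i' j')).
      by move=> h1 h2; apply: (near i' j') => //; apply: clA1; case: (gd i' j' h1 h2).
    have h00 : (i <= i <= i.+1)%N by rewrite leqnn leqnSn.
    have h01 : (i <= i.+1 <= i.+1)%N by rewrite leqnn leqnSn.
    have k00 : (j <= j <= j.+1)%N by rewrite leqnn leqnSn.
    have k01 : (j <= j.+1 <= j.+1)%N by rewrite leqnn leqnSn.
    have t1 := tri _ _ _ (gd _ _ h00 k00) (gd _ _ h01 k00) (gd _ _ h01 k01)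
      (fun x y z x0 y0 z0 xyz => sub _ (ball_convex x0 y0 z0 xyz
        (bl _ _ h00 k00) (bl _ _ h01 k00) (bl _ _ h01 k01))).
    have t2 := tri _ _ _ (gd _ _ h00 k00) (gd _ _ h00 k01) (gd _ _ h01 k01)
      (fun x y z x0 y0 z0 xyz => sub _ (ball_convex x0 y0 z0 xyz
        (bl _ _ h00 k00) (bl _ _ h00 k01) (bl _ _ h01 k01))).
    move: t1 t2.
    move: (L (G i j) (G i.+1 j)) (L (G i j.+1) (G i.+1 j.+1)) (L (G i j) (G i j.+1)).
    by move: (L (G i.+1 j) (G i.+1 j.+1)) (L (G i.+1 j.+1) (G i j)); do 5 case.
  have G0 i : G i 0%N = (1 - i%:R / M%:R) *: e.1 + (i%:R / M%:R) *: e.2.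
    by rewrite /G /grid mul0r sweep0.
  have G00 : G 0%N 0%N = e.1 by rewrite G0 mul0r subr0 scale1r scale0r addr0.
  have GM0 : G M 0%N = e.2 by rewrite G0 M1 subrr scale1r scale0r add0r.
  (* The subdivided segment is replaced by the segment, by coning from its end. *)
  have bottom : \big[addb/false]_(0 <= i < M) L (G i 0%N) (G i.+1 0%N) = L e.1 e.2.
    rewrite (xor_telescope (u := fun i => L e.1 (G i 0%N))) ?G00 ?Lxx ?GM0 // => i iM.
    have g0 := gridg e 0%N 0%N he (leq0n _) (leq0n _).
    have g1 := gridg e i 0%N he (ltnW iM) (leq0n _).
    have g2 := gridg e i.+1 0%N he iM (leq0n _).
    have hull : forall a b c : R, 0 <= a -> 0 <= b -> 0 <= c -> a + b + c = 1 ->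
        U (a *: f (G 0%N 0%N) + b *: f (G i 0%N) + c *: f (G i.+1 0%N)).
      move=> a b c a0 b0 c0 abc; have [hw _] := fineA e he.
      pose s : R := i%:R / M%:R; pose t : R := i.+1%:R / M%:R.
      have bnd k : (k <= M)%N -> 0 <= (k%:R / M%:R : R) <= 1.
        by move=> kM; rewrite divr_ge0 //= ler_pdivrMr ?ltr0n // mul1r ler_nat.
      have /andP[s0 s1] : 0 <= s <= 1 by apply: bnd; exact: ltnW.
      have /andP[t0 t1] : 0 <= t <= 1 by apply: bnd.
      apply: (hw (b * s + c * t)); first by apply/andP; split; nra.
      rewrite (_ : _ + _ *: e.2 = a *: G 0%N 0%N + b *: G i 0%N + c *: G i.+1 0%N).
        apply: hull_close => //; apply: clA1; [exact: g0.1|exact: g1.1|exact: g2.1].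
      rewrite !G0 -/s -/t mul0r (_ : a = 1 - b - c); last by lra.
      by apply/matrixP => k l; rewrite !mxE; ring.
    have := tri _ _ _ g0 g1 g2 hull; rewrite -/(G 0%N 0%N) -/(G i 0%N) -/(G i.+1 0%N).
    rewrite (Lsym (G i.+1 0%N)) // G00.
    by move: (L _ _) (L _ _) (L _ _); do 3 case.
  have topM i : G i M = g top by rewrite /G /grid M1 sweep1.
  have row j : (j < M)%N -> L (G 0%N j) (G 0%N j.+1) (+) L (G M j) (G M j.+1)
    = \big[addb/false]_(0 <= i < M) L (G i j) (G i.+1 j)
      (+) \big[addb/false]_(0 <= i < M) L (G i j.+1) (G i.+1 j.+1).
    move=> jM; rewrite -(xor_telescope (u := fun i => L (G i j) (G i j.+1))
      (F := fun i => L (G i j) (G i.+1 j) (+) L (G i j.+1) (G i.+1 j.+1))).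
      by rewrite big_split.
    by move=> i iM; exact: cell.
  rewrite /W -big_split /=.
  rewrite (eq_bigr (fun j => L (G 0%N j) (G 0%N j.+1) (+) L (G M j) (G M j.+1))).
    rewrite (xor_telescope row) bottom [X in _ = _ (+) X]big1 ?addbF // => i _.
    by rewrite !topM Lxx.
  by move=> j _; rewrite /G /grid mul0r M1 !sweep_left !sweep_right.
rewrite /linking -[RHS](clA W); apply: eq_big_seq => e eA.
rewrite -path_sum_big; apply: path_sum_potential => k ke; apply: key.
by apply/flatten_mapP; exists e.
Qed.
End Contraction.

(** * The 4-cycles of K_{m,n} *)

Section FourCycles.
Variables (m n : nat).
Implicit Types (i k : 'I_m) (j l : 'I_n).

Definition cycle4 i k j l : {set {set K m n}} :=
  [set [set inl i; inr j]; [set inl i; inr l]; [set inl k; inr j]; [set inl k; inr l]]%SET.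

Lemma edge_eq i j k l : ([set inl i; inr j] == [set inl k; inr l] :> {set K m n})%SET
  = (i == k) && (j == l).
Proof.
apply/eqP/andP => [/setP e|[/eqP -> /eqP ->] //].
have := e (inl i); have := e (inr j); rewrite !inE !eqxx /= ?orbT /=.
by move=> /esym e1 /esym e2; split; [move: e2|move: e1]; rewrite ?orbF // => /eqP[->].
Qed.

Lemma mem_cycle4 i k j l (x : 'I_m) (y : 'I_n) : ([set inl x; inr y]%SET \in cycle4 i k j l)
  = ((x == i) || (x == k)) && ((y == j) || (y == l)).
Proof.
rewrite !inE !edge_eq; by case: (x == i); case: (x == k); case: (y == j); case: (y == l).
Qed.

Lemma cycle4_edges i k j l (c : seq (K m n) := [:: inl i; inr j; inl k; inr l]) :
  i != k -> j != l -> [set [set x; next c x] | x in c]%SET = cycle4 i k j l.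
Proof.
move=> ik jl.
have eL (x y : 'I_m) : (inl x == inl y :> K m n) = (x == y) by [].
have eR (x y : 'I_n) : (inr x == inr y :> K m n) = (x == y) by [].
have ki : (k == i) = false by rewrite eq_sym (negbTE ik).
have lj : (l == j) = false by rewrite eq_sym (negbTE jl).
have n1 : next c (inl i) = inr j by rewrite /= eqxx.
have n2 : next c (inr j) = inl k by rewrite /= eqxx.
have n3 : next c (inl k) = inr l by rewrite /= !eL ki eqxx.
have n4 : next c (inr l) = inl i by rewrite /= !eR lj eqxx.
apply/setP => e; apply/imsetP/idP.
  move=> [z]; rewrite !inE => /or4P[] /eqP -> ->; rewrite ?n1 ?n2 ?n3 ?n4.
  - by rewrite eqxx.
  - by rewrite finset.setUC eqxx !orbT.
  - by rewrite eqxx !orbT.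
  - by rewrite finset.setUC eqxx !orbT.
rewrite !inE -!orbA => /or4P[] /eqP ->.
- by exists (inl i); rewrite ?mem_head // n1.
- by exists (inr l); rewrite ?inE ?eqxx ?orbT // n4 finset.setUC.
- by exists (inr j); rewrite ?inE ?eqxx ?orbT // n2 finset.setUC.
- by exists (inl k); rewrite ?inE ?eqxx ?orbT // n3.
Qed.

Lemma cycle4_is_cycle i k j l : i != k -> j != l -> is_cycle (cycle4 i k j l).
Proof.
move=> ik jl; exists [:: inl i; inr j; inl k; inr l]; split => //; last first.
  by rewrite cycle4_edges.
have eL (x y : 'I_m) : (inl x == inl y :> K m n) = (x == y) by [].
have eR (x y : 'I_n) : (inr x == inr y :> K m n) = (x == y) by [].
by rewrite /ucycle /= !inE /= !eL !eR (negbTE ik) (negbTE jl).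
Qed.

Lemma cover_cycle4 i k j l :
  finset.cover (cycle4 i k j l) = [set inl i; inl k; inr j; inr l]%SET.
Proof.
apply/setP => z; rewrite !inE; apply/bigcupP/idP.
  move=> [e]; rewrite !inE -!orbA => /or4P[] /eqP ->; rewrite !inE => /orP[] /eqP ->;
    by rewrite eqxx ?orbT.
rewrite -!orbA => /or4P[] /eqP ->;
  [exists [set inl i; inr j]%SET|exists [set inl k; inr j]%SET
  |exists [set inl i; inr j]%SET|exists [set inl i; inr l]%SET];
  by rewrite ?mem_cycle4 ?inE ?eqxx ?orbT.
Qed.
End FourCycles.

Section Images.
Variables (R : realType) (m n : nat) (f : embedding R (K m n)).
Implicit Types (i k : 'I_m) (j l : 'I_n).

Lemma edge_image_sym (x y : K m n) : adj x y -> edge_image f y x = edge_image f x y.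
Proof.
move=> xy; apply/seteqP; split => p [t /= ht <-]; exists (1 - t);
  move: (ht); rewrite /= !in_itv /= => /andP[t0 t1].
- by apply/andP; split; lra.
- by rewrite -(arc_rev f xy) //= in_itv /= t0.
- by apply/andP; split; lra.
- by rewrite (arc_rev f xy) ?in_itv /= ?subKr //; apply/andP; split; lra.
Qed.

Lemma cycle4_image i k j l : cycle_image f (cycle4 i k j l) =
  [set p | exists x y, [/\ x \in [:: i; k], y \in [:: j; l] & edge_image f (inl x) (inr y) p]].
Proof.
apply/seteqP; split => p /=; last first.
  move=> [x [y [hx hy hp]]]; exists (inl x), (inr y); split => //.
  by rewrite mem_cycle4; move: hx hy; rewrite !inE => -> ->.
move=> [[x|x] [[y|y] [//= _ hC hp]]].
  by exists x, y; rewrite !inE; move: hC; rewrite mem_cycle4 => /andP[-> ->].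
exists y, x; rewrite !inE; move: hC; rewrite finset.setUC mem_cycle4 => /andP[-> ->].
by split => //; rewrite edge_image_sym.
Qed.
End Images.

(** * A non-split pair in every K_{4,4} *)

Section LowerBound.
Variables (R : realType).
Notation V3 := 'rV[R]_3.

Lemma homeomorphism_comp (h k : V3 -> V3) : homeomorphism h -> homeomorphism k ->
  homeomorphism (h \o k).
Proof.
move=> [ch [h' [ch' hK h'K]]] [ck [k' [ck' kK k'K]]]; split.
  by move=> x; exact: (continuous_comp (ck x) (ch _)).
exists (k' \o h'); split.
- by move=> x; exact: (continuous_comp (ch' x) (ck' _)).
- exact: can_comp.
- exact: can_comp.
Qed.

Lemma homeomorphism_inv (h : V3 -> V3) : homeomorphism h ->
  exists2 g, homeomorphism g & cancel h g /\ cancel g h.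
Proof.
by move=> [ch [g [cg hK gK]]]; exists g => //; split => //; exists h.
Qed.

Lemma common_bound (T : eqType) (s : seq T) (Q : T -> (V3 -> V3) -> bool) :
  (forall x, x \in s -> exists (X0 : seq V3) (d : R), 0 < d /\
    forall f (X : seq V3), generic f X -> {subset X0 <= X} ->
      (forall y, y \in X -> `|f y - y| < d) -> Q x f) ->
  exists (X0 : seq V3) (d : R), 0 < d /\
    forall f (X : seq V3), generic f X -> {subset X0 <= X} ->
      (forall y, y \in X -> `|f y - y| < d) -> forall x, x \in s -> Q x f.
Proof.
elim: s => [|x s IH] hs; first by exists [::], 1.
have [X1 [d1 [d10 h1]]] := hs x (mem_head _ _).
have [|X2 [d2 [d20 h2]]] := IH.
  by move=> y ys; apply: hs; rewrite inE ys orbT.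
exists (X1 ++ X2), (Num.min d1 d2); split; first by rewrite lt_min d10.
move=> f X gX sub cl y; rewrite inE => /orP[/eqP -> | ys].
  apply: (h1 f X) => // [z hz|z /cl]; first by apply: sub; rewrite mem_cat hz.
  by rewrite lt_min => /andP[].
apply: (h2 f X) => // [z hz|z /cl]; first by apply: sub; rewrite mem_cat hz orbT.
by rewrite lt_min => /andP[].
Qed.

(** If all nine pairs were split, then the contractions of all nine give finitely many sample
    points; after one perturbation of these all nine linking numbers are even, against
    [K44_linked].  The maps al and be choose the K_{4,4} and its vertices a_0 and b_0. *)
Lemma K44_nonsplit m n (f : embedding R (K m n)) (al : 'I_4 -> 'I_m) (be : 'I_4 -> 'I_n) :
  injective al -> injective be ->
  exists i k k' p q q' : 'I_4, [/\ uniq [:: ord0; i; k; k'], uniq [:: ord0; p; q; q'] &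
    ~ split_link (cycle_image f (cycle4 (al ord0) (al i) (be q) (be q')))
      (cycle_image f (cycle4 (al k) (al k') (be ord0) (be p)))].
Proof.
move=> alI beI; apply: contrapT => no.
have [h hh tame] := emb_tame f; have [g hg [hK gK]] := homeomorphism_inv hh.
pose o (i : nat) : 'I_4 := inord i.
have oI i j : (i < 4)%N -> (j < 4)%N -> o i = o j -> i = j.
  by move=> hi hj /(congr1 val); rewrite /= !inordK.
have o0 : o 0 = ord0 by apply: val_inj; rewrite /= inordK.
pose a' x := h (vert f (inl (al x))); pose b' y := h (vert f (inr (be y))).
have ad x y : @adj (K m n) (inl (al x)) (inr (be y)) by [].
pose c' x y := s2val (cid2 (tame _ _ (ad x y))).
pose a i := a' (o i); pose b j := b' (o j); pose c i j := c' (o i) (o j).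
have c_last i j : last (a i) (c i j) = b j by exact: (s2valP (cid2 (tame _ _ (ad _ _)))).
have c_poly i j : h @` edge_image f (inl (al (o i))) (inr (be (o j))) = polyline (a i) (c i j).
  exact: (s2valP' (cid2 (tame _ _ (ad _ _)))).
have c_disj i j k l : (i < 4)%N -> (j < 4)%N -> (k < 4)%N -> (l < 4)%N ->
    i != k -> j != l -> {in a i :: c i j, forall x, x \notin a k :: c k l}.
  move=> i4 j4 k4 l4 ik jl x hx; apply/negP => hx'.
  have := polyline_mem hx; have := polyline_mem hx'; rewrite -!c_poly.
  move=> [p hp <-] [p' hp' /(can_inj hK) e]; subst p'.
  have ne : ([set inl (al (o i)); inr (be (o j))] != [set inl (al (o k)); inr (be (o l))]
      :> {set K m n})%SET.
    by rewrite edge_eq; apply/negP => /andP[/eqP /alI /(oI _ _ i4 k4) /eqP]; rewrite (negbTE ik).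
  have [z /=] := emb_disj (ad _ _) (ad _ _) ne (conj hp' hp).
  rewrite !inE => /andP[] /orP[] /eqP -> /orP[] /eqP // [].
    by move=> /alI /(oI _ _ i4 k4) /eqP; rewrite (negbTE ik).
  by move=> /beI /(oI _ _ j4 l4) /eqP; rewrite (negbTE jl).
pose path (e : nat * nat) := (a e.1, c e.1 e.2).
pose A (ip : nat * nat) := map path (cycle_edges [:: 0; ip.1]%N (rem ip.2 [:: 1; 2; 3]%N)).
pose B (ip : nat * nat) := map path (cycle_edges (rem ip.1 [:: 1; 2; 3]%N) [:: 0; ip.2]%N).
have cl s s' t t' : closed_chain (map path (cycle_edges [:: s; s'] [:: t; t'])).
  move=> w; rewrite /= !big_cons big_nil /= !c_last.
  by move: (w (a s)) (w (a s')) (w (b t)) (w (b t')); do 4 case.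
pose ips : seq (nat * nat) := [seq (i, k) | i <- [:: 1; 2; 3]%N, k <- [:: 1; 2; 3]%N].
(* A splitting homeomorphism of the embedding becomes one of the polygons by composing with
   the inverse of the taming homeomorphism. *)
have sep s s' t t' u u' v v' :
    split_link (cycle_image f (cycle4 (al (o s)) (al (o s')) (be (o t)) (be (o t'))))
      (cycle_image f (cycle4 (al (o u)) (al (o u')) (be (o v)) (be (o v')))) ->
    exists (X0 : seq V3) (d : R), 0 < d /\ forall f (X : seq V3), generic f X ->
      {subset X0 <= X} -> (forall y, y \in X -> `|f y - y| < d) ->
      ~~ linking f (map path (cycle_edges [:: s; s'] [:: t; t']))
         (map path (cycle_edges [:: u; u'] [:: v; v'])).
  move=> [k [hk kC kD]].
  have [ckg [gk [cgk kgK gkK]]] := homeomorphism_comp hk hg.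
  have [||X0 [d [d0 sepd]]] := @linking_separated _ (k \o g) gk ckg cgk kgK gkK _ _
    (cl s s' t t') (cl u u' v v').
  - move=> _ /mapP[_ /allpairsP[[x y] [/= hx hy ->]] ->] z /=.
    rewrite -c_poly => -[p hp <-] /=; rewrite hK; apply: kC; rewrite cycle4_image.
    exists (al (o x)), (be (o y)); split => //.
      by move: hx; rewrite !inE => /orP[] /eqP ->; rewrite eqxx ?orbT.
    by move: hy; rewrite !inE => /orP[] /eqP ->; rewrite eqxx ?orbT.
  - move=> _ /mapP[_ /allpairsP[[x y] [/= hx hy ->]] ->] z /=.
    rewrite -c_poly => -[p hp <-] /=; rewrite hK; apply: kD; rewrite cycle4_image.
    exists (al (o x)), (be (o y)); split => //.
      by move: hx; rewrite !inE => /orP[] /eqP ->; rewrite eqxx ?orbT.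
    by move: hy; rewrite !inE => /orP[] /eqP ->; rewrite eqxx ?orbT.
  by exists X0, d; split => // f0 X gX sub clX; rewrite (sepd f0 X).
have split i k k' p q q' : uniq [:: 0; i; k; k']%N -> uniq [:: 0; p; q; q']%N ->
    all (fun z => z < 4)%N [:: i; k; k'; p; q; q'] ->
    split_link (cycle_image f (cycle4 (al (o 0)) (al (o i)) (be (o q)) (be (o q'))))
      (cycle_image f (cycle4 (al (o k)) (al (o k')) (be (o 0)) (be (o p)))).
  have ou s : all (fun z => z < 4)%N s -> uniq s -> uniq (map o s).
    by move=> /allP s4 us; rewrite map_inj_in_uniq // => x y /s4 hx /s4 hy; exact: oI.
  move=> u1 u2 /= /and5P[i4 k4 k4' p4 /and3P[q4 q4' _]].
  apply: contrapT => ns; apply: no; exists (o i), (o k), (o k'), (o p), (o q), (o q').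
  rewrite -o0; split => //.
  - by apply: (ou [:: 0; i; k; k']%N) => //=; rewrite i4 k4 k4'.
  - by apply: (ou [:: 0; p; q; q']%N) => //=; rewrite p4 q4 q4'.
have [|X0 [d [d0 hX0]]] := @common_bound _ ips (fun ip f => ~~ linking f (A ip) (B ip)).
  move=> [i p] /allpairsP[[i' p'] [/= + + [-> ->]]]; rewrite /A /B !inE /=.
  by move=> /or3P[] /eqP -> /or3P[] /eqP ->; apply: sep; apply: split.
pose X := X0 ++ flatten [seq a' xy.1 :: c' xy.1 xy.2 |
  xy <- [seq (x, y) | x <- enum 'I_4, y <- enum 'I_4]].
have [pi [gX clX]] := generic_perturbation X d0.
have c_X i j : {subset a i :: c i j <= X}.
  move=> z hz; rewrite mem_cat; apply/orP; right; apply/flatten_mapP.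
  by exists (o i, o j) => //; apply/allpairsP; exists (o i, o j); rewrite !mem_enum.
have [i [p [hi hp hl]]] := K44_linked gX c_last c_X c_disj.
have ipP : (i, p) \in ips.
  apply/allpairsP; exists (i, p); split => //=; rewrite !inE.
    by case: (i) hi => [|[|[|[|]]]].
  by case: (p) hp => [|[|[|[|]]]].
have sub0 : {subset X0 <= X} by move=> z hz; rewrite mem_cat hz.
have /= /negP nl := hX0 pi X gX sub0 clX (i, p) ipP; apply: nl.
move: hl; rewrite /lk2 /lk2_pairs big_allpairs /linking big_map.
by under [X in _ -> is_true X]eq_bigr => e _ do rewrite big_map.
Qed.
End LowerBound.

(** * The lower bound *)

Section Counting.
Variables (R : realType) (m n : nat) (f : embedding R (K m n)).

(** The vertices b_j of a link tell which K_{4,4} it belongs to. *)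
Definition b_ends (L : {set {set {set K m n}}}) : {set 'I_n} :=
  [set j | [exists C in L, inr j \in finset.cover C]]%SET.

Lemma cycle4_disjoint (i k i' k' : 'I_m) (j l j' l' : 'I_n) :
  uniq [:: i; k; i'; k'] -> uniq [:: j; l; j'; l'] ->
  [disjoint finset.cover (cycle4 i k j l) & finset.cover (cycle4 i' k' j' l')]%B.
Proof.
rewrite /= !inE !negb_or => /and4P[/and3P[ik ii ik'] /andP[ki kk'] ii' _].
move=> /and4P[/and3P[jl jj jl'] /andP[lj ll'] jj' _].
rewrite !cover_cycle4 finset.disjoints_subset; apply/fintype.subsetP => z; rewrite !inE -!orbA.
have eL (x y : 'I_m) : (inl x == inl y :> K m n) = (x == y) by [].
have eR (x y : 'I_n) : (inr x == inr y :> K m n) = (x == y) by [].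
case/or4P => /eqP ->; rewrite ?eL ?eR ?negb_or /= ?ii ?ik' ?ki ?kk' ?jj ?jl' ?lj ?ll' //.
Qed.

Lemma cycle4_link (i k i' k' : 'I_m) (j l j' l' : 'I_n) :
  uniq [:: i; k; i'; k'] -> uniq [:: j; l; j'; l'] ->
  ~ split_link (cycle_image f (cycle4 i k j l)) (cycle_image f (cycle4 i' k' j' l')) ->
  [set cycle4 i k j l; cycle4 i' k' j' l']%SET \in links f.
Proof.
move=> ui uj ns; rewrite inE; apply/asboolP.
exists (cycle4 i k j l), (cycle4 i' k' j' l'); split => //; last exact: cycle4_disjoint.
move: ui uj; rewrite /= !inE !negb_or => /and4P[/and3P[ik _ _] _ ii' _].
by move=> /and4P[/and3P[jl _ _] _ jj' _]; split; exact: cycle4_is_cycle.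
Qed.

Lemma b_ends_cycle4 (i k i' k' : 'I_m) (j l j' l' : 'I_n) :
  b_ends [set cycle4 i k j l; cycle4 i' k' j' l'] = [set j; l; j'; l']%SET.
Proof.
have eR (x y : 'I_n) : (inr x == inr y :> K m n) = (x == y) by [].
apply/setP => x; rewrite !inE; apply/existsP/idP => [[C]|].
  by rewrite !inE => /andP[/orP[] /eqP ->]; rewrite cover_cycle4 !inE /= !eR => /orP[] ->;
    rewrite ?orbT.
rewrite -!orbA => h; have [h1|h1] := boolP ((x == j) || (x == l)).
  exists (cycle4 i k j l); rewrite !inE eqxx cover_cycle4 !inE /= !eR.
  by case/orP: h1 => ->; rewrite ?orbT.
exists (cycle4 i' k' j' l'); rewrite !inE eqxx orbT cover_cycle4 !inE /= !eR.
by move: h1 h; rewrite negb_or => /andP[/negbTE -> /negbTE ->] /= ->.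
Qed.
End Counting.

Section LowerCount.
Variables (R : realType) (n : nat) (f : embedding R (K 4 n)).

Lemma four_all (s : seq 'I_4) : uniq s -> size s = 4 -> forall x, x \in s.
Proof.
move=> us ss x; have /subset_cardP h : #|s| = #|'I_4|.
  by rewrite card_ord (card_uniqP us).
by rewrite (h (subset_predT _)).
Qed.

(** In the first link a_0 and b_q lie on the same cycle.  Exchanging b_0 and b_q gives a second
    link, which separates a_0 from b_q. *)
Lemma two_links (S : {set 'I_n}) : #|S| = 4 ->
  (2 <= #|[set L in links f | b_ends L == S]|)%N.
Proof.
move=> S4; pose be (x : 'I_4) : 'I_n := enum_val (cast_ord (esym S4) x).
have beI : injective be by move=> x y /enum_val_inj/cast_ord_inj.
have beS s : uniq s -> size s = 4 -> [set x in map be s]%SET = S.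
  move=> us ss; apply/setP => y; rewrite inE; apply/mapP/idP => [[x _ ->]|yS].
    exact: enum_valP.
  exists (cast_ord S4 (enum_rank_in yS y)); first exact: four_all.
  by rewrite /be cast_ordK enum_rankK_in.
have base (be' : 'I_4 -> 'I_n) : injective be' -> (forall s, uniq s -> size s = 4 ->
    [set x in map be' s]%SET = S) -> exists i k k' p q q' : 'I_4,
    [/\ uniq [:: ord0; i; k; k'], uniq [:: ord0; p; q; q'] &
      [set cycle4 ord0 i (be' q) (be' q'); cycle4 k k' (be' ord0) (be' p)]%SET
        \in [set L in links f | b_ends L == S]].
  move=> beI' beS'; have [i [k [k' [p [q [q' [ui up ns]]]]]]] :=
    @K44_nonsplit R 4 n f id be' (@inj_id _) beI'.
  have u4 : uniq [:: q; q'; ord0; p].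
    by rewrite (perm_uniq (s2 := [:: ord0; p; q; q'])) // (perm_catC [:: q; q'] [:: ord0; p]).
  exists i, k, k', p, q, q'; split => //; rewrite inE; apply/andP; split.
    apply: cycle4_link => //; rewrite -[X in uniq X]/(map be' [:: q; q'; ord0; p]).
    by rewrite map_inj_uniq.
  rewrite b_ends_cycle4 -(beS' _ u4 erefl); apply/eqP/setP => x.
  by rewrite !inE -!orbA.
have [i [k [k' [p [q [q' [ui up h1]]]]]]] := base be beI beS.
pose be1 := be \o tperm ord0 q.
have [||i1 [k1 [k1' [p1 [q1 [q1' [ui1 up1 h2]]]]]]] := base be1.
- by apply: inj_comp => //; exact: perm_inj.
- move=> s us ss; rewrite map_comp; apply: beS; rewrite ?size_map //.
  by rewrite map_inj_uniq //; exact: perm_inj.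
set L1 := [set _; _]%SET in h1; set L2 := [set _; _]%SET in h2.
pose joined (L : {set {set {set K 4 n}}}) :=
  [exists C in L, (inl ord0 \in finset.cover C) && (inr (be q) \in finset.cover C)].
have L1j : joined L1.
  apply/existsP; exists (cycle4 ord0 i (be q) (be q')).
  by rewrite /L1 !inE eqxx /= cover_cycle4 !inE !eqxx ?orbT.
have L2j : ~~ joined L2.
  have e1 : be q = be1 ord0 by rewrite /be1 /= tpermL.
  have be1I : injective be1 by apply: inj_comp => //; exact: perm_inj.
  have eL (x y : 'I_4) : (inl x == inl y :> K 4 n) = (x == y) by [].
  have eR (x y : 'I_n) : (inr x == inr y :> K 4 n) = (x == y) by [].
  move: ui1 up1; rewrite /= !inE !negb_or => /and4P[/and3P[_ n1 n2] _ _ _].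
  move=> /and4P[/and3P[_ n3 n4] _ _ _].
  apply/existsPn => C; apply/negP => /and3P[]; rewrite /L2 !in_set2.
  move=> /orP[] /eqP ->; rewrite !cover_cycle4 !inE ?eL ?(negbTE n1) ?(negbTE n2) //.
  by rewrite e1 /= !eR !(inj_eq be1I) (negbTE n3) (negbTE n4).
have ne : L1 != L2 by apply: contraTneq L1j => ->.
apply: leq_trans (_ : #|[set L1; L2]%SET| <= _)%N; first by rewrite cards2 ne.
by apply: subset_leq_card; apply/fintype.subsetP => L; rewrite !in_set2 => /orP[] /eqP ->.
Qed.

Lemma nlinks_lower : (2 * 'C(n, 4) <= nlinks f)%N.
Proof.
have -> : (2 * 'C(n, 4) = \sum_(S : {set 'I_n} | #|S| == 4) 2)%N.
  rewrite sum_nat_const mulnC; congr (_ * _)%N.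
  by rewrite -[n in 'C(n, _)]card_ord -card_draws cardsE.
rewrite /nlinks -sum1_card (partition_big (@b_ends 4 n) xpredT) //= big_mkcond /=.
apply: leq_sum => S _; case: eqP => [S4|//].
apply: leq_trans (two_links S4) _; rewrite -sum1_card.
by rewrite (eq_bigl (fun L => (L \in links f) && (b_ends L == S))) // => L; rewrite inE.
Qed.
End LowerCount.

(** * Separating compact sets by pushes along the axes *)

Section Separation.
Variable R : realType.
Notation V3 := 'rV[R]_3.
Implicit Types (A B : set V3) (p q : V3).

Definition above A B := forall p q, A p -> B q -> proj p = proj q -> height q < height p.

Lemma proj_continuous : continuous (@proj R).
Proof.
move=> p A /nbhs_ballP[e /= e0 he]; apply/nbhs_ballP; exists e => //= q [_ pq].
by apply: he; split => // i j; rewrite !mxE; exact: pq.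
Qed.

Lemma height_continuous : continuous (@height R).
Proof. exact: coord_continuous. Qed.

(** The only obstruction to a bound of this kind are points with the same projection, where the
    heights differ by a positive amount; compactness makes the bound uniform. *)
Lemma above_gap A B : compact A -> compact B -> above A B ->
  exists2 d : R, 0 < d & forall p q, A p -> B q ->
    d < height p - height q + `|proj p - proj q| / d.
Proof.
move=> cA cB AB.
have /compact_near_coveringP/(_ _ (0 : R)^'+
  (fun d x => d < height x.1 - height x.2 + `|proj x.1 - proj x.2| / d)) cov :
  compact (A `*` B) by exact: compact_setX.
have c1 : continuous (fun x : V3 * V3 => height x.1 - height x.2).
  move=> x; apply: (@cvgB _ R^o).
    by exact: (continuous_comp (@cvg_fst _ _ _ _ _) (@height_continuous _)).
  by exact: (continuous_comp (@cvg_snd _ _ _ _ _) (@height_continuous _)).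
have c2 : continuous (fun x : V3 * V3 => `|proj x.1 - proj x.2|).
  move=> x; apply: cvg_norm; apply: cvgB.
    by exact: (continuous_comp (@cvg_fst _ _ _ _ _) (@proj_continuous _)).
  by exact: (continuous_comp (@cvg_snd _ _ _ _ _) (@proj_continuous _)).
have key x : (A `*` B) x -> \forall x' \near x & d \near (0 : R)^'+,
    d < height x'.1 - height x'.2 + `|proj x'.1 - proj x'.2| / d.
  move=> [Ax Bx]; have [e|ne] := eqVneq (proj x.1) (proj x.2).
    have h0 : 0 < height x.1 - height x.2 by rewrite subr_gt0; exact: AB.
    set a := _ - _ in h0; have a2 : a / 2 < a by lra.
    exists ([set y : V3 * V3 | a / 2 < height y.1 - height y.2],
      [set d | 0 < d /\ d < a / 2]) => /=.
      split; first exact: (cvgr_gt _ (c1 x) _ a2).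
      near=> d; split; near: d; first exact: nbhs_right_gt.
      by apply: nbhs_right_lt; rewrite divr_gt0.
    move=> [y d] /= [hy [d0 da]]; apply: (lt_trans da); apply: (lt_le_trans hy).
    by rewrite lerDl divr_ge0 // ltW.
  have D0 : 0 < `|proj x.1 - proj x.2| by rewrite normr_gt0 subr_eq0.
  set D := `|_| in D0; set a := height x.1 - height x.2.
  have D2 : D / 2 < D by lra.
  have a1 : a - 1 < a by lra.
  have b0 : 0 < D / (2 * (`|a| + 2)) by rewrite divr_gt0 // mulr_gt0 // ltr_wpDl.
  exists ([set y : V3 * V3 | a - 1 < height y.1 - height y.2 /\ D / 2 < `|proj y.1 - proj y.2|],
    [set d | [/\ 0 < d, d < 1 & d < D / (2 * (`|a| + 2))]]) => /=.
    split; first by apply: filterI; [exact: (cvgr_gt _ (c1 x) _ a1)|exact: (cvgr_gt _ (c2 x) _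
      D2)].
    near=> d; split; near: d; [exact: nbhs_right_gt|exact: nbhs_right_lt|exact: nbhs_right_lt].
  move=> [y d] /= [[hy hy'] [d0 d1 d2]].
  have h1 : `|a| + 2 < D / 2 / d.
    rewrite ltr_pdivlMr //; move: d2; rewrite ltr_pdivlMr; last by rewrite mulr_gt0 // ltr_wpDl.
    move: (`|a|) => b; nra.
  have h2 : D / 2 / d < `|proj y.1 - proj y.2| / d by rewrite ltr_pM2r ?invr_gt0.
  have h3 : - `|a| <= a by rewrite lerNl -normrN ler_norm.
  lra.
have [d [d0 hd]] := filter_ex (filterI (nbhs_right_gt 0) (cov _ key)).
by exists d => // p q Ap Bq; exact: (hd (p, q)).
Unshelve. all: by end_near. Qed.

Lemma lipschitz_continuous (phi : 'rV[R]_2 -> R) (K : R) : 0 < K ->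
  (forall v w, phi v <= phi w + K * `|v - w|) -> continuous phi.
Proof.
move=> K0 lip v A /nbhs_ballP[e /= e0 he].
apply/nbhs_ballP; exists (e / K); first by rewrite /= divr_gt0.
move=> w; rewrite -ball_normE /= ltr_pdivlMr // mulrC => h.
apply: he; rewrite -ball_normE /= ltr_norml.
have := lip v w; have := lip w v; rewrite [`|w - v|]distrC; move: h.
by move: (K * _) => x *; apply/andP; split; lra.
Qed.

Lemma compact_bound A (g : V3 -> R) : compact A -> continuous g ->
  exists M, forall p, A p -> `|g p| <= M.
Proof.
move=> cA cg; have cgA : compact (g @` A).
  by apply: continuous_compact => //; exact: continuous_subspaceT.
have hb : \forall M \near +oo, forall x, (g @` A) x -> `|x| <= M.
  exact: (@compact_bounded R R^o _ cgA).
have [M hM] := @filter_ex _ (pinfty_nbhs R) _ _ hb.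
by exists M => p Ap; apply: (hM (g p)); exists p.
Qed.

Lemma compact_neg A (g : V3 -> R) : compact A -> continuous g ->
  (forall p, A p -> g p < 0) -> exists2 e, 0 < e & forall p, A p -> g p <= - e.
Proof.
move=> /compact_near_coveringP/(_ _ (0 : R)^'+ (fun e p => g p <= - e)) cov cg neg.
have key p : A p -> \forall p' \near p & e \near (0 : R)^'+, g p' <= - e.
  move=> Ap; have g2 : g p < g p / 2 by have := neg p Ap; lra.
  have g3 : 0 < - (g p / 2) by have := neg p Ap; lra.
  exists ([set p' | g p' < g p / 2], [set e | e < - (g p / 2)]) => /=.
    by split; [exact: (cvgr_lt _ (cg p) _ g2)|exact: nbhs_right_lt].
  by move=> [p' e] /= [h1 h2]; lra.
have [e [e0 he]] := filter_ex (filterI (nbhs_right_gt 0) (cov _ key)).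
by exists e => // p Ap; exact: he.
Qed.

(** The function is the largest 1/d-Lipschitz function below A, lowered by d/2; by [above_gap] it
    stays above B. *)
Lemma above_separated A B : A !=set0 -> compact A -> compact B -> above A B ->
  exists phi : 'rV[R]_2 -> R, [/\ continuous phi,
    forall p, A p -> phi (proj p) < height p & forall q, B q -> height q < phi (proj q)].
Proof.
move=> [a Aa] cA cB AB; have [d d0 gap] := above_gap cA cB AB.
pose S v := [set height p + d^-1 * `|v - proj p| | p in A].
have [b hb] : exists b, forall p, A p -> b <= height p.
  have [M hM] := compact_bound cA (@height_continuous).
  by exists (- M) => p /hM /ler_normlP[]; lra.
have i0 : 0 < d^-1 by rewrite invr_gt0.
have lbS v : has_lbound (S v).
  exists b => _ [p Ap <-]; apply: le_trans (hb p Ap) _.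
  by rewrite lerDl mulr_ge0 // ltW.
have S0 v : S v !=set0 by exists (height a + d^-1 * `|v - proj a|), a.
pose phi v := inf (S v) - d / 2.
exists phi; split.
- apply: (@lipschitz_continuous _ d^-1) => // v w; rewrite /phi.
  suff : inf (S v) - d^-1 * `|v - w| <= inf (S w) by lra.
  apply: lb_le_inf => // _ [p Ap <-]; rewrite lerBlDr.
  apply: le_trans (ge_inf (lbS v) (ex_intro2 _ _ p Ap erefl)) _.
  rewrite -addrA lerD2l -mulrDr ler_pM2l // [leRHS]addrC.
  have -> : v - proj p = (v - w) + (w - proj p) by rewrite addrA subrK.
  exact: ler_normD.
- move=> p Ap; rewrite /phi.
  have := ge_inf (lbS (proj p)) (ex_intro2 _ _ p Ap erefl).
  rewrite subrr normr0 mulr0; lra.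
- move=> q Bq; rewrite /phi.
  suff : height q + d <= inf (S (proj q)) by lra.
  apply: lb_le_inf => // _ [p Ap <-].
  have := gap p q Ap Bq; rewrite distrC [_ / d]mulrC.
  by move: (d^-1 * _) => x; lra.
Qed.

Definition lift (phi : 'rV[R]_2 -> R) p : V3 := p - phi (proj p) *: delta_mx 0 ord_max.

Lemma proj_addZ p (t : R) : proj (p + t *: delta_mx 0 ord_max) = proj p.
Proof.
apply/rowP => k; rewrite !mxE (_ : (widen_ord _ k == ord_max) = false) ?mulr0 ?addr0 //.
by apply/negbTE; rewrite -val_eqE /= neq_ltn ltn_ord.
Qed.

Lemma proj_lift phi p : proj (lift phi p) = proj p.
Proof. by rewrite /lift -scaleNr proj_addZ. Qed.

Lemma height_lift phi p : height (lift phi p) = height p - phi (proj p).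
Proof. by rewrite /height !mxE eqxx mulr1. Qed.

Lemma lift_homeomorphism phi : continuous phi -> homeomorphism (lift phi).
Proof.
have cl psi : continuous psi -> continuous (lift psi).
  move=> cpsi p; have c : {for p, continuous (fun q => psi (proj q))}.
    exact: (continuous_comp (@proj_continuous p) (cpsi _)).
  exact: (cvgB cvg_id (cvgZ c (cvg_cst _))).
move=> cphi; split; first exact: cl.
exists (lift (fun v => - phi v)); split.
- by apply: cl => v; exact: (cvgN (cphi v)).
- by move=> p; rewrite {1}/lift proj_lift scaleNr opprK /lift subrK.
- by move=> p; rewrite {1}/lift proj_lift /lift scaleNr opprK addrK.
Qed.

Lemma above_split A B : A !=set0 -> compact A -> compact B -> above A B -> split_link A B.
Proof.
move=> A0 cA cB AB; have [phi [cphi hA hB]] := above_separated A0 cA cB AB.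
exists (lift phi); split; first exact: lift_homeomorphism.
- by move=> p Ap; rewrite -[X in _ < X]/(height _) height_lift subr_gt0 hA.
- by move=> p Bp; rewrite -[X in X < _]/(height _) height_lift subr_lt0 hB.
Qed.

Lemma split_link_sym A B : split_link A B -> split_link B A.
Proof.
move=> [h [hh hA hB]]; exists (-%R \o h); split.
- apply: homeomorphism_comp => //; split; first by move=> p; exact: opp_continuous.
  by exists -%R; split; [move=> p; exact: opp_continuous|exact: opprK|exact: opprK].
- by move=> p /hB; rewrite /= mxE oppr_gt0.
- by move=> p /hA; rewrite /= mxE oppr_lt0.
Qed.

Section Shear.
Variable c : 'I_2.
Let c' : 'I_3 := widen_ord (leqnSn 2) c.

(** Only points below height 0 move, so what has been lifted above height 0 stays in place. *)
Definition shear (t : R) p : V3 := p + (t * Num.min (height p) 0) *: delta_mx 0 c'.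

Lemma height_shear t p : height (shear t p) = height p.
Proof.
rewrite /height !mxE (_ : (ord_max == c') = false) ?andbF ?mulr0 ?addr0 //.
by apply/negbTE; rewrite -val_eqE /= neq_ltn ltn_ord orbT.
Qed.

Lemma proj_shear t p k : proj (shear t p) 0 k =
  proj p 0 k + (if k == c then t * Num.min (height p) 0 else 0).
Proof.
rewrite !mxE (_ : (widen_ord _ k == c') = (k == c)); last by rewrite -!val_eqE.
by case: ifP => _; rewrite ?mulr1 ?mulr0.
Qed.

Lemma shear_homeomorphism t : homeomorphism (shear t).
Proof.
have ch s : continuous (shear s).
  move=> p; have c1 : {for p, continuous (fun q : V3 => s * Num.min (height q) 0)}.
    have cm : {for p, continuous ((@height R : V3 -> R^o) \min (fun=> 0))}.
      apply: continuous_min; first exact: height_continuous. exact: (@cst_continuous V3 R^o 0 p).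
    exact: (cvgM (cvg_cst s) cm).
  exact: (cvgD cvg_id (cvgZ c1 (cvg_cst _))).
split; first exact: ch.
exists (shear (- t)); split; first exact: ch.
- by move=> p; rewrite {1}/shear height_shear mulNr scaleNr addrK.
- by move=> p; rewrite {1}/shear height_shear /shear mulNr scaleNr subrK.
Qed.

(** Where a push towards smaller values of coordinate c could move a point across B. *)
Definition beyond B (v : 'rV[R]_2) := exists q, [/\ B q, proj q 0 c <= v 0 c &
  proj q 0 (rev_ord c) = v 0 (rev_ord c)].

Lemma beyond_compact A B : compact A -> compact B ->
  compact (A `&` [set p | beyond B (proj p)]).
Proof.
move=> cA cB.
pose F (x : V3 * V3) := proj x.2 0 c - proj x.1 0 c.
pose G (x : V3 * V3) := proj x.2 0 (rev_ord c) - proj x.1 0 (rev_ord c).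
have cc (k : 'I_2) : continuous (fun x : V3 * V3 => proj x.2 0 k - proj x.1 0 k).
  have cp : continuous (fun p : V3 => proj p 0 k).
    by move=> p; exact: (continuous_comp (@proj_continuous p) (@coord_continuous _ _ _ 0 k _)).
  move=> x; apply: (@cvgB _ R^o).
    exact: (continuous_comp (@cvg_snd _ _ _ _ _) (cp _)).
  exact: (continuous_comp (@cvg_fst _ _ _ _ _) (cp _)).
have clF : closed [set x | F x <= 0].
  rewrite (_ : mkset _ = F @^-1` [set r : R | r <= 0]) //.
  by apply: closed_comp; [move=> x _; exact: cc|exact: closed_le].
have clG : closed [set x | G x = 0].
  rewrite (_ : mkset _ = G @^-1` [set r : R | r = 0]) //.
  by apply: closed_comp; [move=> x _; exact: cc|exact: closed_eq].
have cAB : compact ((A `*` B) `&` ([set x | F x <= 0] `&` [set x | G x = 0])).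
  by apply: compact_closedI; [exact: compact_setX|exact: closedI].
rewrite (_ : _ `&` _ = fst @` ((A `*` B) `&` ([set x | F x <= 0] `&` [set x | G x = 0]))).
  apply: continuous_compact => //; apply: continuous_subspaceT => x; exact: cvg_fst.
apply/seteqP; split => p.
  move=> [Ap [q [Bq h1 h2]]]; exists (p, q) => //; split => //; split; rewrite /= /F /G /=.
    by rewrite subr_le0.
  by rewrite h2 subrr.
move=> [[p' q] [[/= Ap Bq] [h1 h2]] <-]; split => //; exists q; split => //.
  by move: h1; rewrite /F /= subr_le0.
by apply/eqP; rewrite -subr_eq0; apply/eqP; exact: h2.
Qed.

(** Lift by a function separating A2 from B and from the part F of A1 that is beyond B; then push
    the half-space below height 0, which contains A2, so far that A2 leaves the half-plane over
    which B lies.  The part of A1 outside F may move too, but not across B.  Afterwards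
    A1 and A2 are nowhere below B. *)
Lemma sandwich_split A1 A2 B : compact A1 -> compact A2 -> compact B ->
  A2 !=set0 -> B !=set0 ->
  above A1 B -> above B A2 ->
  (forall p q, A1 p -> A2 q -> proj p = proj q -> beyond B (proj p) -> height q < height p) ->
  (forall q, B q -> 0 <= proj q 0 c) ->
  split_link (A1 `|` A2) B.
Proof.
move=> cA1 cA2 cB [a2 A2a] [b Bb] A1B BA2 far B0.
pose F := A1 `&` [set p | beyond B (proj p)].
have cF : compact F by exact: beyond_compact.
have [||phi [cphi hi lo]] := @above_separated (B `|` F) A2 _ (compactU cB cF) cA2.
- by exists b; left.
- by move=> p q [Bp|[A1p Fp]] A2q e; [exact: BA2|exact: far].
pose h1 := lift phi; have hh1 := lift_homeomorphism cphi.
have [e e0 he] : exists2 e, 0 < e & forall p, A2 p -> height (h1 p) <= - e.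
  apply: (@compact_neg _ (fun p => height (h1 p))) => //.
    by move=> p; case: hh1 => c1 _; exact: (continuous_comp (c1 p) (@height_continuous _)).
  by move=> p A2p; rewrite height_lift subr_lt0; exact: lo.
have [M hM] : exists M, forall p, A2 p -> `|proj p 0 c| <= M.
  apply: (@compact_bound _ (fun p => proj p 0 c)) => // p.
  exact: (continuous_comp (@proj_continuous p) (@coord_continuous _ _ _ 0 c _)).
pose t := (M + 1) / e.
have M0 : 0 <= M by apply: le_trans (hM _ A2a).
have t0 : 0 < t by rewrite divr_gt0 // ltr_wpDl.
pose h2 := shear t; have hh2 := shear_homeomorphism t.
have hh := homeomorphism_comp hh2 hh1.
have ch : continuous (h2 \o h1) by case: hh.
have cim (S : set V3) : compact S -> compact ((h2 \o h1) @` S).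
  by move=> cS; apply: continuous_compact => //; exact: continuous_subspaceT.
have [||||h3 [hh3 pos neg]] := @above_split ((h2 \o h1) @` (A1 `|` A2)) ((h2 \o h1) @` B).
- by exists ((h2 \o h1) a2), a2 => //; right.
- by apply: cim; exact: compactU.
- exact: cim.
- move=> _ _ [p Ap <-] [q Bq <-] /= epq.
  rewrite /h1 /h2 !height_shear !height_lift.
  have hq : 0 < height (h1 q) by rewrite height_lift subr_gt0; apply: hi; left.
  have eq' k : proj p 0 k + (if k == c then t * Num.min (height (h1 p)) 0 else 0) = proj q 0 k.
    have : proj (h2 (h1 p)) 0 k = proj (h2 (h1 q)) 0 k by rewrite epq.
    rewrite /h2 !proj_shear !proj_lift [Num.min (height (h1 q)) 0]min_r ?(ltW hq) //.
    by rewrite mulr0 if_same addr0.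
  have ec := eq' c; have ec' := eq' (rev_ord c).
  have c_rev : (rev_ord c == c) = false by case: (c) => -[|[|]].
  rewrite eqxx in ec; rewrite c_rev addr0 in ec'.
  (* A point of A1 that lands over or under B was beyond B, so it has not been pushed. *)
  case: Ap => [A1p|A2p].
    have bp : beyond B (proj p).
      exists q; split => //.
      rewrite -ec gerDl; apply: mulr_ge0_le0; first exact: ltW.
      by rewrite ge_min lexx orbT.
    have hp : 0 < height (h1 p) by rewrite height_lift subr_gt0; apply: hi; right.
    have epq' : proj p = proj q.
      apply/rowP => k; rewrite -(eq' k) [Num.min _ 0]min_r ?(ltW hp) //.
      by rewrite mulr0 if_same addr0.
    by rewrite epq' ltrD2r; apply: A1B.
  exfalso; have := B0 q Bq; rewrite -ec.
  have := he p A2p; have := hM p A2p; move/ler_normlP => [_ hpM].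
  move=> hpe; rewrite min_l; last by lra.
  have : t * height (h1 p) <= t * - e by rewrite ler_pM2l.
  rewrite mulrN /t divfK ?gt_eqF //; lra.
exists (h3 \o (h2 \o h1)); split; first exact: homeomorphism_comp.
- by move=> p Ap; apply: pos; exists p.
- by move=> p Bp; apply: neg; exists p.
Qed.
End Shear.
End Separation.

(** * Split pairs in the fan embedding *)

Section FanGeometry.
Variables (R : realType) (m n : nat) (f : embedding R (K m n)).
Hypothesis fan : is_fan f.
Implicit Types (i k : 'I_m) (j l : 'I_n).
Notation V3 := 'rV[R]_3.
Notation edge i j := (edge_image f (inl i) (inr j)).

Lemma edge_compact i j : compact (edge i j).
Proof.
apply: continuous_compact; last exact: segment_compact.
have ij : @adj (K m n) (inl i) (inr j) by [].
exact: (emb_cont ij).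
Qed.

Lemma edge_nonempty i j : edge i j !=set0.
Proof. by exists (arc f (inl i) (inr j) 0), 0; rewrite //= in_itv /= lexx ler01. Qed.

Lemma edge_proj i j p : edge i j p -> exists t, [/\ 0 <= t <= 1,
  proj p 0 0 = (1 - t) * i.+1%:R & proj p 0 1 = t * j.+1%:R].
Proof.
move=> hp; have [_ _ /(_ i j)[e _] _] := fan.
have : (segment (pt i.+1%:R 0) (pt 0 j.+1%:R)) (proj p) by rewrite -e; exists p.
move=> [t /=]; rewrite in_itv /= => ht <-; exists t; split => //; rewrite !mxE /=; ring.
Qed.

(** Two segments with end points on the two half-axes meet only if the one that starts nearer to
    the origin on the first axis ends farther on the second. *)
Lemma fan_over i k j l p q : edge i j p -> edge k l q -> i != k -> j != l ->
  proj p = proj q ->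
  [/\ (i < k)%N, (l < j)%N & height q < height p] \/
  [/\ (k < i)%N, (j < l)%N & height p < height q].
Proof.
move=> hp hq ik jl e; have [_ _ _ cr] := fan.
have [t [/andP[t0 t1] px py]] := edge_proj hp; have [s [/andP[s0 s1] qx qy]] := edge_proj hq.
rewrite e in px py.
have ex : (1 - t) * i.+1%:R = (1 - s) * k.+1%:R :> R by rewrite -px -qx.
have ey : t * j.+1%:R = s * l.+1%:R :> R by rewrite -py -qy.
have pos (z : nat) : 0 < z.+1%:R :> R by rewrite ltr0n.
have lt1 (a b : nat) : (a < b)%N -> a.+1%:R < b.+1%:R :> R by rewrite ltr_nat.
have no (a b c d : R) : 0 < a -> a < b -> 0 < c -> c < d -> forall u v : R, 0 <= u <= 1 ->
    0 <= v <= 1 -> (1 - u) * a = (1 - v) * b -> u * c = v * d -> False.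
  move=> a0 ab c0 cd u v /andP[u0 u1] /andP[v0 v1] e1 e2.
  have uv : v <= u by nra.
  have vu : u <= v by nra.
  have euv : u = v by lra.
  subst v; have : u = 0 by nra. have : u = 1 by nra. lra.
have [il|il|/val_inj il] := ltngtP i k; last by rewrite il eqxx in ik.
- have [jl'|jl'|/val_inj jl'] := ltngtP j l; last by rewrite jl' eqxx in jl.
  + by exfalso; apply: (no _ _ _ _ (pos i) (lt1 _ _ il) (pos j) (lt1 _ _ jl') t s) => //;
    apply/andP.
  + by left; split => //; exact: (cr i k j l).
- have [jl'|jl'|/val_inj jl'] := ltngtP j l; last by rewrite jl' eqxx in jl.
  + by right; split => //; exact: (cr k i l j).
  + by exfalso; apply: (no _ _ _ _ (pos k) (lt1 _ _ il) (pos l) (lt1 _ _ jl') s t) => //;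
    apply/andP.
Qed.

Lemma cycle4_image_edges i k j l : cycle_image f (cycle4 i k j l) =
  (edge i j `|` edge i l) `|` (edge k j `|` edge k l).
Proof.
rewrite cycle4_image; apply/seteqP; split => p /=.
  move=> [x [y [+ + hp]]]; rewrite !inE => /orP[] /eqP ? /orP[] /eqP ?; subst x y.
  - by left; left. - by left; right. - by right; left. - by right; right.
move=> [[]|[]] hp; [exists i, j|exists i, l|exists k, j|exists k, l]; split => //;
  by rewrite !inE eqxx ?orbT.
Qed.

Lemma cycle4_swap_a i k j l : cycle4 i k j l = cycle4 k i j l.
Proof. by apply/setP => e; rewrite !inE; case: (e == _); case: (e == _); rewrite ?orbT ?orbF. Qed.

Lemma cycle4_swap_b i k j l : cycle4 i k j l = cycle4 i k l j.
Proof.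
apply/setP => e; rewrite !inE -!orbA.
by case: (e == _); case: (e == _); case: (e == _); rewrite ?orbT ?orbF.
Qed.

Lemma cycle4_compact i k j l : compact (cycle_image f (cycle4 i k j l)).
Proof. by rewrite cycle4_image_edges; do !apply: compactU; exact: edge_compact. Qed.

Lemma cycle4_nonempty i k j l : cycle_image f (cycle4 i k j l) !=set0.
Proof. by rewrite cycle4_image_edges; have [p hp] := edge_nonempty i j; exists p; left; left. Qed.

Lemma fan_split_a i k i' k' j l j' l' : j != j' -> j != l' -> l != j' -> l != l' ->
  (i < i')%N -> (i < k')%N -> (k < i')%N -> (k < k')%N ->
  split_link (cycle_image f (cycle4 i k j l)) (cycle_image f (cycle4 i' k' j' l')).
Proof.
move=> jj jl lj ll ii ik ki kk; apply: above_split;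
  [exact: cycle4_nonempty|exact: cycle4_compact|exact: cycle4_compact|].
move=> p q; rewrite !cycle4_image => -[x [y [hx hy hp]]] [x' [y' [hx' hy' hq]]] e.
have xx : (x < x')%N.
  by move: hx hx'; rewrite !inE => /orP[] /eqP -> /orP[] /eqP ->.
have yy : y != y'.
  by move: hy hy'; rewrite !inE => /orP[] /eqP -> /orP[] /eqP ->.
have [|[]|[]] // := fan_over hp hq _ yy e; first by rewrite -val_eqE /= ltn_eqF.
by move=> xx'; have := ltn_trans xx xx'; rewrite ltnn.
Qed.

Lemma fan_split_b i k i' k' j l j' l' : i != i' -> i != k' -> k != i' -> k != k' ->
  (j' < j)%N -> (l' < j)%N -> (j' < l)%N -> (l' < l)%N ->
  split_link (cycle_image f (cycle4 i k j l)) (cycle_image f (cycle4 i' k' j' l')).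
Proof.
move=> ii ik ki kk jj jl lj ll; apply: above_split;
  [exact: cycle4_nonempty|exact: cycle4_compact|exact: cycle4_compact|].
move=> p q; rewrite !cycle4_image => -[x [y [hx hy hp]]] [x' [y' [hx' hy' hq]]] e.
have xx : x != x'.
  by move: hx hx'; rewrite !inE => /orP[] /eqP -> /orP[] /eqP ->.
have yy : (y' < y)%N.
  by move: hy hy'; rewrite !inE => /orP[] /eqP -> /orP[] /eqP ->.
have [|[]|[]] // := fan_over hp hq xx _ e; first by rewrite eq_sym -val_eqE /= ltn_eqF.
by move=> _ yy'; have := ltn_trans yy yy'; rewrite ltnn.
Qed.

(** The star of a_i passes over, and the star of a_k under, the other cycle; the star of a_k
    is pushed across the second axis.  The first star is over the second except at the common
    vertices b_j and b_l, which the other cycle does not obstruct. *)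
Lemma fan_split_nested_a i k i' k' j l j' l' : j != j' -> j != l' -> l != j' -> l != l' ->
  (i < i')%N -> (i < k')%N -> (i' < k)%N -> (k' < k)%N ->
  split_link (cycle_image f (cycle4 i k j l)) (cycle_image f (cycle4 i' k' j' l')).
Proof.
move=> jj jl lj ll ii ik ki kk; rewrite cycle4_image_edges.
have yy y y' : y \in [:: j; l] -> y' \in [:: j'; l'] -> y != y'.
  by rewrite !inE => /orP[] /eqP -> /orP[] /eqP ->.
have ed x p : (edge x j `|` edge x l) p -> exists2 y, y \in [:: j; l] & edge x y p.
  by move=> [hp|hp]; [exists j|exists l]; rewrite ?inE ?eqxx ?orbT.
have lt_ne (x x' : 'I_m) : (x < x')%N -> x != x' by move=> h; rewrite -val_eqE /= ltn_eqF.
have [b hb] := cycle4_nonempty i' k' j' l'; have [a ha] := edge_nonempty k j.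
apply: (sandwich_split (c := 0)).
- by apply: compactU; exact: edge_compact.
- by apply: compactU; exact: edge_compact.
- exact: cycle4_compact.
- by exists a; left.
- by exists b.
- move=> p q /ed[y hy hp]; rewrite cycle4_image => -[x' [y' [hx' hy' hq]]] e.
  have xx : (i < x')%N by move: hx'; rewrite !inE => /orP[] /eqP ->.
  have [[_ _ //]|[xx' _ _]] := fan_over hp hq (lt_ne _ _ xx) (yy _ _ hy hy') e.
  by have := ltn_trans xx xx'; rewrite ltnn.
- move=> p q; rewrite cycle4_image => -[x' [y' [hx' hy' hp]]] /ed[y hy hq] e.
  have xx : (x' < k)%N by move: hx'; rewrite !inE => /orP[] /eqP ->.
  have yn : y' != y by rewrite eq_sym; exact: yy.
  have [[_ _ //]|[xx' _ _]] := fan_over hp hq (lt_ne _ _ xx) yn e.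
  by have := ltn_trans xx xx'; rewrite ltnn.
- move=> p q /ed[y hy hp] /ed[y' hy' hq] e [r []].
  have xx : (i < k)%N by exact: ltn_trans ii ki.
  have [yE|yn] := eqVneq y y'; last first.
    have [[_ _ //]|[xx' _ _]] := fan_over hp hq (lt_ne _ _ xx) yn e.
    by have := ltn_trans xx xx'; rewrite ltnn.
  subst y'; rewrite cycle4_image => -[x' [y' [hx'' hy'' hr]]].
  have [t [/andP[t0 t1] px py]] := edge_proj hp.
  have [s [/andP[s0 s1] qx qy]] := edge_proj hq.
  have [u [/andP[u0 u1] rx ry]] := edge_proj hr.
  rewrite (_ : rev_ord 0 = 1) ?rx ?ry ?px ?py; last exact: val_inj.
  have yn : y != y' by exact: yy.
  rewrite e qx qy in px py.
  have pos (z : nat) : 0 < z.+1%:R :> R by rewrite ltr0n.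
  have ik1 : i.+1%:R < k.+1%:R :> R by rewrite ltr_nat.
  have st : s = t by have := pos y; nra.
  have t1' : t = 1 by subst s; have := pos i; nra.
  rewrite t1' subrr mul0r mul1r => le0.
  have -> : u = 1 by have := pos x'; nra.
  by rewrite mul1r => /eqP; rewrite eqr_nat eqSS => /eqP/val_inj yy'; rewrite yy' eqxx in yn.
- move=> q; rewrite cycle4_image => -[x' [y' [_ _ /edge_proj[t [/andP[t0 t1] -> _]]]]].
  by apply: mulr_ge0; [lra|exact: ler0n].
Qed.

(** The same with the roles of the axes exchanged. *)
Lemma fan_split_nested_b i k i' k' j l j' l' : i != i' -> i != k' -> k != i' -> k != k' ->
  (j < j')%N -> (j < l')%N -> (j' < l)%N -> (l' < l)%N ->
  split_link (cycle_image f (cycle4 i k j l)) (cycle_image f (cycle4 i' k' j' l')).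
Proof.
move=> ii ik ki kk jj jl lj ll.
have -> : cycle_image f (cycle4 i k j l) = (edge i l `|` edge k l) `|` (edge i j `|` edge k j).
  rewrite cycle4_image_edges; apply/seteqP; split => p.
    by move=> [[]|[]] hp; [right; left|left; left|right; right|left; right].
  by move=> [[]|[]] hp; [left; right|right; right|left; left|right; left].
have xx x x' : x \in [:: i; k] -> x' \in [:: i'; k'] -> x != x'.
  by rewrite !inE => /orP[] /eqP -> /orP[] /eqP ->.
have ed y p : (edge i y `|` edge k y) p -> exists2 x, x \in [:: i; k] & edge x y p.
  by move=> [hp|hp]; [exists i|exists k]; rewrite ?inE ?eqxx ?orbT.
have lt_ne (y y' : 'I_n) : (y < y')%N -> y' != y by move=> h; rewrite eq_sym -val_eqE /= ltn_eqF.
have [b hb] := cycle4_nonempty i' k' j' l'; have [a ha] := edge_nonempty i j.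
apply: (sandwich_split (c := 1)).
- by apply: compactU; exact: edge_compact.
- by apply: compactU; exact: edge_compact.
- exact: cycle4_compact.
- by exists a; left.
- by exists b.
- move=> p q /ed[x hx hp]; rewrite cycle4_image => -[x' [y' [hx' hy' hq]]] e.
  have yy : (y' < l)%N by move: hy'; rewrite !inE => /orP[] /eqP ->.
  have [[_ _ //]|[_ yy' _]] := fan_over hp hq (xx _ _ hx hx') (lt_ne _ _ yy) e.
  by have := ltn_trans yy yy'; rewrite ltnn.
- move=> p q; rewrite cycle4_image => -[x' [y' [hx' hy' hp]]] /ed[x hx hq] e.
  have yy : (j < y')%N by move: hy'; rewrite !inE => /orP[] /eqP ->.
  have xn : x' != x by rewrite eq_sym; exact: xx.
  have [[_ _ //]|[_ yy' _]] := fan_over hp hq xn (lt_ne _ _ yy) e.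
  by have := ltn_trans yy yy'; rewrite ltnn.
- move=> p q /ed[x hx hp] /ed[x' hx' hq] e [r []].
  have yy : (j < l)%N by exact: ltn_trans jj lj.
  have [xE|xn] := eqVneq x x'; last first.
    have [[_ _ //]|[_ yy' _]] := fan_over hp hq xn (lt_ne _ _ yy) e.
    by have := ltn_trans yy yy'; rewrite ltnn.
  subst x'; rewrite cycle4_image => -[x' [y' [hx'' hy'' hr]]].
  have [t [/andP[t0 t1] px py]] := edge_proj hp.
  have [s [/andP[s0 s1] qx qy]] := edge_proj hq.
  have [u [/andP[u0 u1] rx ry]] := edge_proj hr.
  rewrite (_ : rev_ord 1 = 0) ?rx ?ry ?px ?py; last exact: val_inj.
  have xn : x != x' by exact: xx.
  rewrite e qx qy in px py.
  have pos (z : nat) : 0 < z.+1%:R :> R by rewrite ltr0n.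
  have jl1 : j.+1%:R < l.+1%:R :> R by rewrite ltr_nat.
  have st : s = t by have := pos x; nra.
  have t0' : t = 0 by subst s; have := pos j; nra.
  rewrite t0' subr0 mul0r mul1r => le0.
  have -> : u = 0 by have := pos y'; nra.
  by rewrite subr0 mul1r => /eqP; rewrite eqr_nat eqSS => /eqP/val_inj xx';
    rewrite xx' eqxx in xn.
- move=> q; rewrite cycle4_image => -[x' [y' [_ _ /edge_proj[t [/andP[t0 t1] _ ->]]]]].
  by apply: mulr_ge0; [lra|exact: ler0n].
Qed.
End FanGeometry.

(** * The upper bound *)

Section Cycles.
Variables (m n : nat).

Lemma mem_cover_cycle (c : seq (K m n)) x : x \in c ->
  x \in finset.cover [set [set z; next c z] | z in c]%SET.
Proof.
move=> xc; apply/bigcupP; exists [set x; next c x]%SET; last by rewrite !inE eqxx.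
exact: imset_f.
Qed.

(** A longer cycle is to be excluded by its third vertex a_z: two disjoint cycles of K_{4,n} have
    at most four vertices a_i together. *)
Lemma cycle_shape (C : {set {set K m n}}) : is_cycle C ->
  exists (i k : 'I_m) (j l : 'I_n), [/\ i != k, j != l,
    [/\ inl i \in finset.cover C, inl k \in finset.cover C,
        inr j \in finset.cover C & inr l \in finset.cover C] &
    C = cycle4 i k j l \/ exists z : 'I_m, [/\ z != i, z != k & inl z \in finset.cover C]].
Proof.
move=> [c [sz /andP[cyc uc] eC]].
have {c sz cyc uc eC} [c' [sz cyc uc [eC [i hd]]]] : exists c' : seq (K m n), [/\ (2 < size c')%N,
    cycle (@adj (K m n)) c', uniq c' &
    C = [set [set z; next c' z] | z in c']%SET /\ exists i, ohead c' = Some (inl i)].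
  case: c sz cyc uc eC => [//|[i|j] c] sz cyc uc eC.
    by exists (inl i :: c); split => //; split => //; exists i.
  exists (rot 1 (inr j :: c)); split; rewrite ?size_rot ?rot_cycle ?rot_uniq //; split.
    rewrite eC; apply/setP => e; apply/imsetP/imsetP => -[z hz ->]; exists z;
      by rewrite ?next_rot // ?mem_rot // -(mem_rot 1).
  case: c sz cyc uc eC => [//|[i|j'] c] sz cyc _ _; last by move: cyc; rewrite /=.
  by exists i; rewrite rot1_cons.
case: c' sz cyc uc eC hd => [//|x0 [//|x1 [//|x2 c]]] _ + + eC [x0E]; subst x0.
case: x1 eC => [?|j] eC; first by rewrite /=.
case: x2 eC => [k|?] eC; last by rewrite /=.
case: c eC => [|x3 c] eC; first by rewrite /=.
case: x3 eC => [?|l] eC; first by rewrite /=.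
move=> cyc uc; exists i, k, j, l.
have ik : i != k.
  by move: uc; rewrite /= !inE !negb_or => /andP[/and4P[_ ik _ _] _].
have jl : j != l.
  by move: uc; rewrite /= !inE !negb_or => /and3P[_ /and3P[_ jl _] _].
split => //.
  by rewrite eC; split; apply: mem_cover_cycle; rewrite !inE eqxx ?orbT.
case: c eC cyc uc => [|[z|w] c] eC cyc uc; last by move: cyc; rewrite /=.
  by left; rewrite eC cycle4_edges.
right; exists z; move: uc; rewrite /= !inE !negb_or =>
  /and4P[/and5P[_ _ _ iz _] _ /and3P[_ kz _] _].
split.
- by rewrite eq_sym in iz.
- by rewrite eq_sym in kz.
by rewrite eC; apply: mem_cover_cycle; rewrite !inE eqxx ?orbT.
Qed.

Lemma cycle_sorted (C : {set {set K m n}}) : is_cycle C ->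
  exists (i k : 'I_m) (j l : 'I_n), [/\ (i < k)%N, (j < l)%N,
    [/\ inl i \in finset.cover C, inl k \in finset.cover C,
        inr j \in finset.cover C & inr l \in finset.cover C] &
    C = cycle4 i k j l \/ exists z : 'I_m, [/\ z != i, z != k & inl z \in finset.cover C]].
Proof.
move=> /cycle_shape[i [k [j [l [ik jl [ci ck cj cl] hC]]]]].
have [lt_ik|lt_ki|/val_inj e] := ltngtP i k; last by rewrite e eqxx in ik.
  have [lt_jl|lt_lj|/val_inj e] := ltngtP j l; last by rewrite e eqxx in jl.
    by exists i, k, j, l.
  by exists i, k, l, j; rewrite cycle4_swap_b.
have hC' : C = cycle4 k i j l \/ exists z : 'I_m, [/\ z != k, z != i & inl z \in finset.cover C].
  by rewrite cycle4_swap_a; case: hC => [|[z [*]]]; [left|right; exists z].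
have [lt_jl|lt_lj|/val_inj e] := ltngtP j l; last by rewrite e eqxx in jl.
  by exists k, i, j, l.
by exists k, i, l, j; rewrite cycle4_swap_b.
Qed.
End Cycles.

Lemma ltn_neq (p : nat) (x y : 'I_p) : (x < y)%N -> x != y.
Proof. by move=> h; rewrite -val_eqE /= ltn_eqF. Qed.

Lemma enum_sorted (p : nat) (s : seq 'I_p) : sorted (fun x y : 'I_p => x < y)%N s ->
  enum [set x in s]%SET = s.
Proof.
move=> ss; apply: (@irr_sorted_eq _ (fun x y : 'I_p => x < y)%N) => //.
- by move=> y x z; exact: ltn_trans.
- by move=> x; rewrite ltnn.
- rewrite /enum_mem; apply: sorted_filter.
    by move=> y x z; exact: ltn_trans.
  have := iota_ltn_sorted 0 p; rewrite -val_enum_ord sorted_map.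
  by rewrite enumT.
- by move=> x; rewrite mem_enum inE.
Qed.

Section UpperCount.
Variables (R : realType) (n : nat) (f : embedding R (K 4 n)).
Implicit Types (i k : 'I_4) (j l : 'I_n).

Lemma disjoint_cycles (C D : {set {set K 4 n}}) : is_cycle C -> is_cycle D ->
  [disjoint finset.cover C & finset.cover D]%B ->
  exists i k i' k' j l j' l', [/\ uniq [:: i; k; i'; k'], uniq [:: j; l; j'; l'],
    [/\ (i < k)%N, (i' < k')%N, (j < l)%N & (j' < l')%N] &
    C = cycle4 i k j l /\ D = cycle4 i' k' j' l'].
Proof.
move=> /cycle_sorted[i [k [j [l [lik ljl [ci ck cj cl] hC]]]]].
move=> /cycle_sorted[i' [k' [j' [l' [lik' ljl' [ci' ck' cj' cl'] hD]]]]] dis.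
have ik := ltn_neq lik; have jl := ltn_neq ljl.
have ik' := ltn_neq lik'; have jl' := ltn_neq ljl'.
have ne x y : x \in finset.cover C -> y \in finset.cover D -> x != y.
  by move=> hx hy; apply: contraTneq hx => ->; rewrite (disjointFl dis hy).
have u4 : uniq [:: i; k; i'; k'].
  have h1 := ne _ _ ci ci'; have h2 := ne _ _ ci ck'; have h3 := ne _ _ ck ci'.
  have h4 := ne _ _ ck ck'.
  by rewrite /= !inE !negb_or ik ik' h1 h2 h3 h4.
have uj : uniq [:: j; l; j'; l'].
  have h1 := ne _ _ cj cj'; have h2 := ne _ _ cj cl'; have h3 := ne _ _ cl cj'.
  have h4 := ne _ _ cl cl'.
  by rewrite /= !inE !negb_or jl jl' h1 h2 h3 h4.
have all4 := four_all u4 erefl.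
exists i, k, i', k', j, l, j', l'; split => //; split.
- case: hC => [//|[z [zi zk cz]]].
  have h1 := ne _ _ cz ci'; have h2 := ne _ _ cz ck'.
  have := all4 z; rewrite !inE (negbTE zi) (negbTE zk) /=.
  by move=> /orP[] /eqP e; [move: h1|move: h2]; rewrite e eqxx.
- case: hD => [//|[z [zi zk cz]]].
  have h1 := ne _ _ ci cz; have h2 := ne _ _ ck cz.
  have := all4 z; rewrite !inE (negbTE zi) (negbTE zk) !orbF.
  by move=> /orP[] /eqP e; [move: h1|move: h2]; rewrite e eqxx.
Qed.

Hypothesis fan : is_fan f.

(** Both the a_i and the b_j of a link interleave, since otherwise one of the four separations of
    the previous part applies. *)
Lemma fan_link_order i k i' k' j l j' l' : uniq [:: i; k; i'; k'] -> uniq [:: j; l; j'; l'] ->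
  (i < k)%N -> (i' < k')%N -> (i < i')%N -> (j < l)%N -> (j' < l')%N ->
  ~ split_link (cycle_image f (cycle4 i k j l)) (cycle_image f (cycle4 i' k' j' l')) ->
  [/\ i = inord 0, k = inord 2, i' = inord 1 & k' = inord 3] /\
  ([/\ (j < j')%N, (j' < l)%N & (l < l')%N] \/ [/\ (j' < j)%N, (j < l')%N & (l' < l)%N]).
Proof.
rewrite /= !inE !negb_or => /and4P[/and3P[_ ii ik'] /andP[ki kk] _ _].
move=> /and4P[/and3P[_ jj jl'] /andP[lj ll] _ _] ik i'k' ii' jl j'l' ns.
have ik'' : (i < k')%N by exact: ltn_trans i'k'.
have ns' := fun h => ns (split_link_sym h).
split.
  have i'k : (i' < k)%N.
    rewrite ltnNge leq_eqVlt negb_or val_eqE ki /=; apply/negP => h; apply: ns.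
    by apply: fan_split_a => //; exact: ltn_trans i'k'.
  have kk' : (k < k')%N.
    rewrite ltnNge leq_eqVlt negb_or val_eqE eq_sym kk /=; apply/negP => h; apply: ns.
    exact: fan_split_nested_a.
  have := ltn_ord k'; have := ltn_ord i; have e p (x : 'I_4) : val x = p -> (p < 4)%N -> x =
    inord p.
    by move=> e p4; apply: val_inj; rewrite e /= inordK.
  by move=> h1 h2; split; apply: e => //=; lia.
have lj' : (j' < l)%N.
  rewrite ltnNge leq_eqVlt negb_or val_eqE lj /=; apply/negP => h; apply: ns'.
  apply: fan_split_b; rewrite ?[_ == i]eq_sym ?[_ == k]eq_sym //; lia.
have l'j : (j < l')%N.
  rewrite ltnNge leq_eqVlt negb_or val_eqE eq_sym jl' /=; apply/negP => h; apply: ns.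
  by apply: fan_split_b => //; lia.
have [h|h|h] := ltngtP j j'.
- left; split => //; rewrite ltnNge leq_eqVlt negb_or val_eqE eq_sym ll /=; apply/negP => h';
  apply: ns.
  exact: fan_split_nested_b.
- right; split => //; rewrite ltnNge leq_eqVlt negb_or val_eqE ll /=; apply/negP => h';
  apply: ns'.
  by apply: fan_split_nested_b => //; rewrite eq_sym.
- by move: jj; rewrite -val_eqE /= h eqxx.
Qed.

(** The links that remain, indexed by the four vertices b_j and the choice of the two on the cycle
    through a_0: first and third, or second and fourth. *)
Definition fan_link (d : 'I_n) (x : {set 'I_n} * bool) : {set {set {set K 4 n}}} :=
  let b t := nth d (enum x.1) t in
  (if x.2 then [set cycle4 (inord 0) (inord 2) (b 0) (b 2);
             cycle4 (inord 1) (inord 3) (b 1) (b 3)]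
  else [set cycle4 (inord 0) (inord 2) (b 1) (b 3);
            cycle4 (inord 1) (inord 3) (b 0) (b 2)])%SET.

Lemma fan_link_ordered (d x0 x1 x2 x3 : 'I_n) (c : bool) :
  (x0 < x1)%N -> (x1 < x2)%N -> (x2 < x3)%N ->
  fan_link d ([set x in [:: x0; x1; x2; x3]]%SET, c) =
  (if c then [set cycle4 (inord 0) (inord 2) x0 x2; cycle4 (inord 1) (inord 3) x1 x3]
   else [set cycle4 (inord 0) (inord 2) x1 x3; cycle4 (inord 1) (inord 3) x0 x2])%SET
  /\ #|[set x in [:: x0; x1; x2; x3]]%SET| = 4.
Proof.
move=> h0 h1 h2.
have e : enum [set x in [:: x0; x1; x2; x3]]%SET = [:: x0; x1; x2; x3].
  by apply: enum_sorted; rewrite /= h0 h1 h2.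
by rewrite /fan_link /= e cardE e.
Qed.

Lemma fan_links_sub (d : 'I_n) :
  links f \subset [set fan_link d x | x in finset.setX [set S : {set 'I_n} | #|S| == 4]%SET
    [set: bool]]%SET.
Proof.
apply/fintype.subsetP => L; rewrite inE => /asboolP[C [D [-> [hC hD] dis ns]]].
have ns' := fun h => ns (split_link_sym h).
have [i [k [i' [k' [j [l [j' [l' [ui uj [ik ik' jl jl'] [eC eD]]]]]]]]]] :=
  disjoint_cycles hC hD dis.
subst C D; have [ii|ii|/val_inj ii] := ltngtP i i'; last first.
- by move: ui; rewrite ii /= !inE eqxx orbT.
- have ui' : uniq [:: i'; k'; i; k].
    by rewrite (perm_uniq (s2 := [:: i; k; i'; k'])) // (perm_catC [:: i'; k'] [:: i; k]).
  have uj' : uniq [:: j'; l'; j; l].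
    by rewrite (perm_uniq (s2 := [:: j; l; j'; l'])) // (perm_catC [:: j'; l'] [:: j; l]).
  have [[-> -> -> ->] o] := fan_link_order ui' uj' ik' ik ii jl' jl ns'.
  rewrite finset.setUC; case: o => -[h1 h2 h3].
    have [e c4] := fan_link_ordered d true h1 h2 h3.
    by rewrite -e; apply: imset_f; rewrite !inE c4 eqxx.
  have [e c4] := fan_link_ordered d false h1 h2 h3.
  by rewrite -e; apply: imset_f; rewrite !inE c4 eqxx.
have [[-> -> -> ->] o] := fan_link_order ui uj ik ik' ii jl jl' ns.
case: o => -[h1 h2 h3].
  have [e c4] := fan_link_ordered d true h1 h2 h3.
  by rewrite -e; apply: imset_f; rewrite !inE c4 eqxx.
have [e c4] := fan_link_ordered d false h1 h2 h3.
by rewrite -e; apply: imset_f; rewrite !inE c4 eqxx.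
Qed.

Lemma nlinks_upper : (0 < n)%N -> (nlinks f <= 2 * 'C(n, 4))%N.
Proof.
move=> hn; have d := Ordinal hn.
apply: leq_trans (subset_leq_card (fan_links_sub d)) _.
apply: leq_trans (leq_imset_card _ _) _.
by rewrite cardsX card_draws card_ord cardsT card_bool mulnC.
Qed.
End UpperCount.

(** * Realization of the fan diagram, and the minimum *)

Section FanEmbedding.
Variables (R : realType) (m n : nat).
Notation V3 := 'rV[R]_3.

Definition point3 (x y z : R) : V3 :=
  \row_k (if k == 0 then x else if k == 1 then y else z).

(** The vertices a_i and b_j lie on two skew lines, so the segments joining them meet in common
    ends only.  The b_j are put below the plane, since this makes steeper segments pass over. *)
Definition fan_vert (v : K m n) : V3 :=
  match v with inl i => point3 i.+1%:R 0 0 | inr j => point3 0 j.+1%:R (-1) end.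

Definition fan_arc (v w : K m n) (t : R) : V3 := (1 - t) *: fan_vert v + t *: fan_vert w.

Lemma point3_inj x y z x' y' z' : point3 x y z = point3 x' y' z' -> [/\ x = x', y = y' & z = z'].
Proof.
move=> /rowP e; split; first by have := e 0; rewrite !mxE.
  by have := e 1; rewrite !mxE.
by have := e ord_max; rewrite !mxE.
Qed.

Lemma fan_arcE (i : 'I_m) (j : 'I_n) t :
  fan_arc (inl i) (inr j) t = point3 ((1 - t) * i.+1%:R) (t * j.+1%:R) (- t).
Proof.
by apply/rowP => k; rewrite !mxE; case: ifP => _; [|case: ifP => _]; ring.
Qed.

Lemma fan_arc_rev v w t : fan_arc w v t = fan_arc v w (1 - t).
Proof. by rewrite /fan_arc subKr addrC. Qed.

Lemma fan_arc_image v w : fan_arc w v @` `[0, 1] = fan_arc v w @` `[0, 1].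
Proof.
apply/seteqP; split => p [t /=]; rewrite in_itv /= => ht <-; exists (1 - t);
  rewrite -?fan_arc_rev ?subKr //= in_itv /=; apply/andP; split; lra.
Qed.

Lemma nat_eqR (a b : nat) : a.+1%:R = b.+1%:R :> R -> a = b.
Proof. by move=> /eqP; rewrite eqr_nat eqSS => /eqP. Qed.

Lemma fan_vert_inj : injective fan_vert.
Proof.
move=> [i|j] [k|l] /= /point3_inj[e1 e2 e3].
- by congr inl; apply/val_inj/nat_eqR.
- by exfalso; lra.
- by exfalso; lra.
- by congr inr; apply/val_inj/nat_eqR.
Qed.

Lemma fan_arc_vert (i : 'I_m) (j : 'I_n) (z : K m n) t :
  fan_arc (inl i) (inr j) t = fan_vert z -> z = inl i \/ z = inr j.
Proof.
rewrite fan_arcE; case: z => [k|l] /= /point3_inj[e1 e2 e3].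
  have t0 : t = 0 by lra.
  by left; congr inl; apply/val_inj/nat_eqR; rewrite -e1 t0 subr0 mul1r.
have t0 : t = 1 by lra.
by right; congr inr; apply/val_inj/nat_eqR; rewrite -e2 t0 mul1r.
Qed.

Lemma fan_arc_disj (i k : 'I_m) (j l : 'I_n) p :
  ([set inl i; inr j] != [set inl k; inr l] :> {set K m n})%SET ->
  (fan_arc (inl i) (inr j) @` `[0, 1]) p -> (fan_arc (inl k) (inr l) @` `[0, 1]) p ->
  [set fan_vert z | z in [set z | z \in [set inl i; inr j]%SET :&: [set inl k; inr l]%SET]] p.
Proof.
rewrite edge_eq negb_and => ne [t /=]; rewrite in_itv /= => /andP[t0 t1] <- [s _].
rewrite !fan_arcE => /point3_inj[e1 e2 e3].
have st : s = t by lra.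
subst s; have [tz|tz] := eqVneq t 0.
  subst t; rewrite subr0 !mul1r in e1; have ki : k = i by apply/val_inj/nat_eqR.
  subst k; exists (inl i); first by rewrite /= !inE eqxx.
  by rewrite /= mul0r subr0 mul1r oppr0.
have [to|to] := eqVneq t 1.
  subst t; rewrite !mul1r in e2; have lj : l = j by apply/val_inj/nat_eqR.
  subst l; exists (inr j); first by rewrite /= !inE eqxx orbT.
  by rewrite /= subrr mul0r mul1r.
have ki : k = i by apply/val_inj/nat_eqR; apply: (mulfI _ e1); rewrite subr_eq0 eq_sym.
have lj : l = j by apply/val_inj/nat_eqR; exact: (mulfI tz e2).
by rewrite ki lj !eqxx in ne.
Qed.

Lemma fan_exists : exists f : embedding R (K m n), is_fan f.
Proof.
have arc0 x y : adj x y -> fan_arc x y 0 = fan_vert x.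
  by move=> _; rewrite /fan_arc subr0 scale1r scale0r addr0.
have arc1 x y : adj x y -> fan_arc x y 1 = fan_vert y.
  by move=> _; rewrite /fan_arc subrr scale1r scale0r add0r.
have rev x y : adj x y -> forall t, t \in `[0, 1] -> fan_arc y x t = fan_arc x y (1 - t).
  by move=> _ t _; exact: fan_arc_rev.
have cont x y : adj x y -> {within `[0, 1], continuous (fan_arc x y)}.
  move=> _; apply: continuous_subspaceT.
  by apply: mix_continuous => t; [exact: cvg_id|exact: cvg_cst|exact: cvg_cst].
have inj x y : adj x y -> {in `[0, 1] &, injective (fan_arc x y)}.
  case: x y => [i|j] [k|l] //= _ t s _ _.
    by rewrite !fan_arcE => /point3_inj[_ _ /oppr_inj].
  rewrite ![fan_arc (inr _) _ _]fan_arc_rev !fan_arcE => /point3_inj[_ _ /oppr_inj]; lra.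
have vrt x y z : adj x y -> z != x -> z != y -> ~ (fan_arc x y @` `[0, 1]) (fan_vert z).
  case: x y => [i|j] [k|l] // _ zx zy.
    by move=> [t _ /fan_arc_vert[] e]; [move: zx|move: zy]; rewrite e eqxx.
  rewrite fan_arc_image.
  by move=> [t _ /fan_arc_vert[] e]; [move: zy|move: zx]; rewrite e eqxx.
have disj x y u v : adj x y -> adj u v -> [set x; y]%SET != [set u; v]%SET ->
  (fan_arc x y @` `[0, 1]) `&` (fan_arc u v @` `[0, 1]) `<=`
    [set fan_vert z | z in [set z | z \in [set x; y]%SET :&: [set u; v]%SET]].
  case: x y u v => [i|j] [k|l] [i'|j'] [k'|l'] // _ _ ne p [h1 h2].
  - exact: fan_arc_disj.
  - by move: ne h2; rewrite fan_arc_image (finset.setUC [set inr j']%SET) => ne h2;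
    exact: fan_arc_disj.
  - by move: ne h1; rewrite fan_arc_image (finset.setUC [set inr j]%SET) => ne h1;
    exact: fan_arc_disj.
  - move: ne h1 h2; rewrite ![fan_arc (inr _) _ @` _]fan_arc_image.
    rewrite (finset.setUC [set inr j]%SET) (finset.setUC [set inr j']%SET) => ne h1 h2.
    exact: fan_arc_disj.
have tame : exists2 h : V3 -> V3, homeomorphism h &
    forall x y : K m n, adj x y -> exists2 s, last (h (fan_vert x)) s = h (fan_vert y) &
      h @` (fan_arc x y @` `[0, 1]) = polyline (h (fan_vert x)) s.
  have cid : continuous (id : V3 -> V3) by move=> p; exact: cvg_id.
  exists id; first by split => //; exists id.
  move=> x y xy; exists [:: fan_vert y] => //=; rewrite image_id.
  apply/seteqP; split => p; first by move=> [t ht <-]; left; exists t.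
  case=> [[t ht <-]|->]; first by exists t.
  by exists 1; [rewrite /= in_itv /= lexx ler01|exact: arc1].
exists (@Embedding R (K m n) fan_vert fan_arc fan_vert_inj arc0 arc1 rev cont inj vrt disj tame).
have proj3 x y z : proj (point3 x y z) = pt x y.
  apply/rowP => k; rewrite !mxE -!val_eqE /=.
  by case: k => -[|[|]].
split=> /=.
- by move=> i; rewrite proj3.
- by move=> j; rewrite proj3.
- move=> i j; split.
    apply/seteqP; split => v.
      move=> [p [t ht <-] <-]; exists t => //; rewrite /= fan_arcE proj3.
      by apply/rowP => k; rewrite !mxE; case: ifP => _; ring.
    move=> [t ht <-]; exists (fan_arc (inl i) (inr j) t); first by exists t.
    by rewrite /= fan_arcE proj3; apply/rowP => k; rewrite !mxE; case: ifP => _; ring.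
  move=> t s _ _ /=; rewrite !fan_arcE !proj3 => /rowP/(_ 0); rewrite !mxE /= => e.
  have /(mulIf _) : (1 - t) * i.+1%:R = (1 - s) * i.+1%:R :> R by exact: e.
  by rewrite pnatr_eq0 => /(_ isT); lra.
move=> i k j l ik lj p q [t /= ht <-] [s /= hs <-].
move: ht hs; rewrite !in_itv /= => /andP[t0 t1] /andP[s0 s1].
rewrite !fan_arcE !proj3 => /rowP e; have := e 0; have := e 1; rewrite !mxE /= => e1 e0.
rewrite /height !mxE /= ltrN2.
have pos (z : nat) : 0 < z.+1%:R :> R by rewrite ltr0n.
have ik1 : i.+1%:R < k.+1%:R :> R by rewrite ltr_nat.
have lj1 : l.+1%:R < j.+1%:R :> R by rewrite ltr_nat.
rewrite ltNge; apply/negP => st.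
have := pos i; have := pos l; move=> pl pi.
have t00 : t = 0 by nra.
have s00 : s = 0 by nra.
move: e0; rewrite t00 s00; lra.
Qed.
End FanEmbedding.

Theorem theorem3 (R : realType) (n : nat) (hn : (0 < n)%N) :
  mnl R (K 4 n) = (2 * 'C(n, 4))%N /\
  (exists f : embedding R (K 4 n), is_fan f) /\
  (forall f : embedding R (K 4 n), is_fan f -> nlinks f = mnl R (K 4 n)).
Proof.
have fanE (f : embedding R (K 4 n)) : is_fan f -> nlinks f = (2 * 'C(n, 4))%N.
  by move=> fan; apply/eqP; rewrite eqn_leq nlinks_upper // nlinks_lower.
have [f0 fan0] := fan_exists R 4 n.
have mnlE : mnl R (K 4 n) = (2 * 'C(n, 4))%N.
  rewrite /mnl; case: xgetP => [k _ [[f <-] min]|/(_ (2 * 'C(n, 4))%N)[]].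
    by apply/eqP; rewrite eqn_leq nlinks_lower andbT -(fanE _ fan0) min.
  by split; [exists f0; exact: fanE|exact: nlinks_lower].
split => //; split; first by exists f0.
by move=> f fan; rewrite mnlE fanE.
Qed.
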